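(* Let $0<\delta<\pi/2$ and, for each integer $n\ge 1$, let $T_\delta(\mathbb{S}^{n-1})\subseteq\mathbb{S}^n$ be the tube of radius $\delta$ around the totally geodesic equator $\mathbb{S}^{n-1}\subset\mathbb{S}^n$, and let $B_{\pi/2-\delta}(p_N)\subseteq\mathbb{S}^n$ be the geodesic ball of radius $\pi/2-\delta$ centered at the north pole $p_N$. Write $s(x)=\mathrm{dist}_{\mathbb{S}^n}(x,\mathbb{S}^{n-1})$ and $t(y)=\mathrm{dist}_{\mathbb{S}^n}(y,p_N)$. (i) The mean exit time function $u_{\delta,n}$ of $T_\delta(\mathbb{S}^{n-1})$ is the solution of $$\Delta_{\mathbb{S}^n}u_{\delta,n}+1=0 \text{ in } T_\delta(\mathbb{S}^{n-1}),\qquad u_{\delta,n}=0 \text{ on } \partial T_\delta(\mathbb{S}^{n-1}),$$ it is radial (that is, $u_{\delta,n}(x)=u_{\delta,n}(s(x))$ depends only on $s(x)$), and $$u_{\delta,n}(x)\ \ge\ F_{\delta,n}(s(x))\qquad\text{for all } x\in T_\delta(\mathbb{S}^{n-1}),$$ where $$F_{\delta,n}(r)=\frac{\delta-r}{\sin\delta}\cdot\frac{1-\cos^n(r)}{n\cos^{n-1}(r)},\qquad r\in[0,\delta].$$ Moreover, $\lim_{n\to\infty}F_{\delta,n}(r)=\infty$ for all $r\in(0,\delta)$. (ii) The mean exit time function $v_{\delta,n}$ of $B_{\pi/2-\delta}(p_N)$ is the solution of $$\Delta_{\mathbb{S}^n}v_{\delta,n}+1=0 \text{ in } B_{\pi/2-\delta}(p_N),\qquad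 v_{\delta,n}=0 \text{ on } \partial B_{\pi/2-\delta}(p_N),$$ it is radial (it depends only on $t(y)$), and for all $y\in B_{\pi/2-\delta}(p_N)$ $$v_{\delta,n}(y)\ \le\ G_{\delta,n}:=\frac{1-\cos(\pi/2-\delta)}{n\cos(\pi/2-\delta)},$$ and $\lim_{n\to\infty}G_{\delta,n}=0$.
   Context: $\mathbb{S}^n\subset\mathbb{R}^{n+1}$ is the unit sphere with the round metric of curvature $1$, $p_N=(0,\dots,0,1)$, and the equator is $\mathbb{S}^{n-1}=\partial B_{\pi/2}(p_N)$, the set of points at distance $\pi/2$ from $p_N$. The tube is $T_\delta(\mathbb{S}^{n-1})=\{x\in\mathbb{S}^n:\mathrm{dist}_{\mathbb{S}^n}(x,\mathbb{S}^{n-1})\le\delta\}$, with boundary $\partial T_\delta(\mathbb{S}^{n-1})=\{x:\mathrm{dist}_{\mathbb{S}^n}(x,\mathbb{S}^{n-1})=\delta\}$. For a domain $\Omega$ in a complete Riemannian manifold, the mean exit time function is $E_\Omega(x)=\mathbb{E}(\tau^x_\Omega)$, where $\tau_\Omega^x=\inf\{t>0: X_t\notin\Omega\}$ and $X_t$ is Brownian motion started at $X_0=x$. Brownian motion is normalized to have generator the Laplace–Beltrami operator $\Delta$ (the trace of the Hessian), so that $\Delta E_\Omega=-1$ in $\Omega$ and $E_\Omega=0$ on $\partial\Omega$ for the domains considered. *)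

(* Defs.v *)
From HB Require Import structures.
From mathcomp Require Import all_boot all_order all_algebra.
From mathcomp Require Import all_classical all_reals all_analysis.
Set Implicit Arguments.
Unset Strict Implicit.
Unset Printing Implicit Defensive.
Import Order.TTheory GRing.Theory Num.Theory.
Import numFieldNormedType.Exports.
Local Open Scope classical_set_scope.
Local Open Scope ring_scope.

Section Sphere.
Context {R : realType} {n : nat}.
Implicit Types (x y : 'rV[R]_n.+1) (D Gamma : set 'rV[R]_n.+1).
Implicit Types (f g : 'rV[R]_n.+1 -> R).

Definition dotr x y : R := (x *m y^T) 0 0.

(* The unit n-sphere of R^(n+1).  The library norm on row vectors is the
   sup norm, so the Euclidean one is written with [dotr]. *)
Definition sphere : set 'rV[R]_n.+1 := [set x | dotr x x = 1].

(* Geodesic distance of the round metric of curvature 1: the angle between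
   two unit vectors. *)
Definition sdist x y : R := acos (dotr x y).

Definition north_pole : 'rV[R]_n.+1 := delta_mx 0 ord_max.

Definition equator : set 'rV[R]_n.+1 :=
  [set z | sphere z /\ sdist z north_pole = pi / 2].

Definition dist_equator x : R := inf [set sdist x z | z in equator].

Definition tube (delta : R) : set 'rV[R]_n.+1 :=
  [set x | sphere x /\ dist_equator x <= delta].

Definition tube_boundary (delta : R) : set 'rV[R]_n.+1 :=
  [set x | sphere x /\ dist_equator x = delta].

Definition geodesic_ball (p : 'rV[R]_n.+1) (r : R) : set 'rV[R]_n.+1 :=
  [set y | sphere y /\ sdist y p < r].

Definition geodesic_sphere (p : 'rV[R]_n.+1) (r : R) : set 'rV[R]_n.+1 :=
  [set y | sphere y /\ sdist y p = r].

Definition partial (i : 'I_n.+1) f : 'rV[R]_n.+1 -> R :=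
  fun x => 'D_(delta_mx 0 i) f x.

Definition C2_euclidean (V : set 'rV[R]_n.+1) f : Prop :=
  forall x, V x ->
    [/\ differentiable f x,
        forall i, differentiable (partial i f) x &
        forall i j, {for x, continuous (partial j (partial i f))}].

(* A function on a subset D of the sphere is C^2 if around each point of D it
   is the restriction to the sphere of a C^2 function of the ambient space.
   Values off the sphere are irrelevant. *)
Definition C2_sphere D f : Prop :=
  forall x, D x -> exists V g,
    [/\ open V, V x, C2_euclidean V g &
        forall y, V y -> sphere y -> f y = g y].

(* The rows of E form an orthonormal basis of the tangent space x^\perp. *)
Definition tangent_frame x (E : 'M[R]_(n, n.+1)) : Prop :=
  E *m E^T = 1%:M /\ E *m x^T = 0.

(* Unit-speed geodesic issued from x with unit initial velocity e. *)
Definition geodesic x (e : 'rV[R]_n.+1) (t : R) : 'rV[R]_n.+1 :=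
  cos t *: x + sin t *: e.

(* [has_laplacian f x l]: the trace of the Hessian of f at x is l, where
   Hess f (e, e) is the second derivative at 0 of f along the geodesic with
   initial velocity e.  For f of class C^2 near x the sum does not depend on
   the frame, so l is unique. *)
Definition has_laplacian f x (l : R) : Prop :=
  forall E, tangent_frame x E ->
    \sum_(i < n) derive1n 2 (f \o geodesic x (row i E)) 0 = l.

Definition poisson_solution D Gamma f : Prop :=
  [/\ C2_sphere D f,
      {within D `|` Gamma, continuous f},
      (forall x, D x -> exists2 l, has_laplacian f x l & l + 1 = 0) &
      forall x, Gamma x -> f x = 0].

Definition is_the_poisson_solution D Gamma f : Prop :=
  poisson_solution D Gamma f /\
  forall g, poisson_solution D Gamma g ->
    forall x, (D `|` Gamma) x -> g x = f x.

End Sphere.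

Section Process.
Context {R : realType} {n : nat} {d : measure_display} {W : measurableType d}.
Context (P : probability W R).
Implicit Types (X : R -> W -> 'rV[R]_n.+1) (F : R -> set (set W)).

Definition natural_filtration X (t : R) : set (set W) :=
  <<s [set A | exists r i (B : set R),
         [/\ 0 <= r <= t, measurable B & A = [set w | B (X r w 0 i)]]] >>.

Definition martingale F (M : R -> W -> R) : Prop :=
  [/\ forall t, 0 <= t ->
        forall B : set R, measurable B -> F t (M t @^-1` B),
      forall t, 0 <= t -> P.-integrable setT (EFin \o M t) &
      forall s t, 0 <= s -> s <= t -> forall A, F s A ->
        (\int[P]_(w in A) (M t w)%:E = \int[P]_(w in A) (M s w)%:E)%E].

(* Brownian motion on the sphere started at x: the continuous process solving
   the martingale problem for the Laplace-Beltrami operator Delta (and not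
   Delta / 2), in its own filtration. *)
Definition brownian_motion (x : 'rV[R]_n.+1) X : Prop :=
  [/\ forall t, 0 <= t -> forall i,
        measurable_fun setT (fun w => X t w 0 i : R),
      forall w, X 0 w = x,
      forall t w, 0 <= t -> sphere (X t w),
      forall w, {within `[0, +oo[, continuous (fun t => X t w)} &
      forall f Lf : 'rV[R]_n.+1 -> R,
        C2_sphere sphere f ->
        (forall y, sphere y -> has_laplacian f y (Lf y)) ->
        martingale (natural_filtration X)
          (fun t w => f (X t w) - f (X 0 w)
             - \int[lebesgue_measure]_(s in `[0, t]) Lf (X s w))].

Definition exit_time X (Omega : set 'rV[R]_n.+1) (w : W) : \bar R :=
  ereal_inf [set t%:E | t in [set t : R | 0 < t /\ ~ Omega (X t w)]].

Definition expected_exit_time X (Omega : set 'rV[R]_n.+1) : \bar R :=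
  (\int[P]_w exit_time X Omega w)%E.

End Process.

(* The mean exit time function of Omega, computed from one Brownian motion X x
   on a probability space (W x, P x) for each starting point x. *)
Definition mean_exit_time {R : realType} {n : nat} {d : measure_display}
    {W : 'rV[R]_n.+1 -> measurableType d}
    (P : forall x, probability (W x) R)
    (X : forall x, R -> W x -> 'rV[R]_n.+1)
    (Omega : set 'rV[R]_n.+1) (x : 'rV[R]_n.+1) : \bar R :=
  expected_exit_time (P x) (X x) Omega.

Definition tube_bound {R : realType} (delta : R) (n : nat) (r : R) : R :=
  (delta - r) / sin delta * ((1 - cos r ^+ n) / (n%:R * cos r ^+ n.-1)).

Definition ball_bound {R : realType} (delta : R) (n : nat) : R :=
  (1 - cos (pi / 2 - delta)) / (n%:R * cos (pi / 2 - delta)).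

(* Main.v *)
(** Everything depends on the height [z = x_N] only. For a function [h] of one
    variable, the Laplacian of [x |-> h (x_N)] on the sphere is
    [(1 - z^2) h'' - n z h'], so both Poisson problems reduce to a linear ODE,
    of first order in [h'], whose solution is a hypergeometric power series in
    [z^2] for the tube and in [1 - z] for the cap; the latter is regular at the
    pole. The bounds on [h] come from the mean value theorem, and uniqueness
    from the maximum principle applied to [g - (1 + eps) u], whose second
    derivative along some geodesic is positive at every interior point.

    To identify the mean exit time, extend [h] to a C^2 function on the line and
    let [M] be the martingale given by the martingale problem. Stopping [M] at
    the first exit of the closed set along a finite grid is elementary, and
    refining the grid gives [E (rho + h (z_rho)) = h (x_N)] for [rho] the exit
    time capped at [T]. Since [h] vanishes at the boundary and is bounded by
    [B], the integrand lies between [rho] and [(1 + B / T) rho], and letting [T]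
    grow gives [E tau = h (x_N)], also when [x] is a boundary point. The open
    cap is squeezed between closed caps. *)

Require Import Defs.
From HB Require Import structures.
From mathcomp Require Import all_boot all_order all_algebra.
From mathcomp Require Import all_classical all_reals all_analysis.
From mathcomp Require Import measurable_realfun.
From mathcomp Require Import ring lra.
Set Implicit Arguments.
Unset Strict Implicit.
Unset Printing Implicit Defensive.
Import Order.TTheory GRing.Theory Num.Theory.
Import numFieldNormedType.Exports.
Local Open Scope classical_set_scope.
Local Open Scope ring_scope.

(** * Power series with a ratio limit *)

(** Power series replace the iterated integrals of powers of cos that a direct integration of the
    ODE would give: termwise differentiation supplies [h'] and [h''] at once, and the equation
    becomes an identity between coefficients. The extension to the line is forced by the martingale
    problem, whose test functions must be C^2 on the whole sphere, while the tube series breaks down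
    at the poles.

    The factor 1 + eps makes the Laplacian of the difference strictly positive, so the elementary
    second derivative test at a maximum already gives a contradiction.

    The natural filtration is not assumed right-continuous, so the exit time of a closed set need
    not be a stopping time for it. A grid uses only events decided at deterministic times. Refining
    it recovers the exit time because the complement of a closed set is open: a path that gets
    outside stays there for a while, and a fine grid sees it. An open cap can be left by touching
    its boundary for an instant, hence the detour through closed caps. Finiteness of the mean exit
    time is not presupposed; it results from the upper bound, uniform in the cap T. *)

Section PowerSeries.
Context {R : realType}.
Implicit Types (c : R^nat) (x y rho : R).

Lemma ratio_test (c : R^nat) (q : R) : 0 < q < 1 ->
  (\forall n \near \oo, `|c n.+1| <= q * `|c n|) -> cvgn (series c).
Proof.
move=> /andP[q0 q1] [N _ cN].
pose B := \sum_(i < N.+1) `|c i| / q ^+ i.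
have B0 : 0 <= B by apply: sumr_ge0 => i _; rewrite divr_ge0// exprn_ge0// ltW.
have cB n : `|c n| <= B * q ^+ n.
  have [nN|Nn] := leqP n N.
    rewrite -ler_pdivrMr ?exprn_gt0// /B (bigD1 (Ordinal (n:=N.+1) (m:=n) nN))//=.
    by rewrite lerDl; apply: sumr_ge0 => i _; rewrite divr_ge0// exprn_ge0// ltW.
  elim: n Nn => // n IHn; rewrite ltnS leq_eqVlt => /predU1P[Nn|Nn].
    subst n; apply: le_trans (cN N (leqnn N)) _.
    rewrite exprS mulrCA ler_pM2l// -ler_pdivrMr ?exprn_gt0//.
    by rewrite /B big_ord_recr/= lerDr; apply: sumr_ge0 => i _; rewrite divr_ge0// exprn_ge0// ltW.
  apply: le_trans (cN n (ltnW Nn)) _.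
  by rewrite exprS mulrCA ler_pM2l// IHn.
apply: normed_cvg; apply: (@series_le_cvg _ _ (geometric B q)) => [n|n|n|].
- exact: normr_ge0.
- by apply: mulr_ge0 => //; rewrite exprn_ge0// ltW.
- exact: cB.
- by apply: is_cvg_geometric_series; rewrite gtr0_norm.
Qed.

(** The ratio is taken in product form, so that no coefficient has to be nonzero. For [rho > 0] it
    gives convergence when [|x| < rho^-1], and it passes to formal derivatives and primitives. *)
Definition ratio_limit c rho :=
  exists2 r : R^nat, r @ \oo --> rho & \forall n \near \oo, c n.+1 = r n * c n.

Lemma ratio_limit_cvg c rho x :
  ratio_limit c rho -> `|rho * x| < 1 -> cvgn (pseries c x).
Proof.
move=> [r rrho cr] rx1.
pose q := (1 + `|rho * x|) / 2.
have q01 : 0 < q < 1 by rewrite /q; have := normr_ge0 (rho * x); lra.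
apply: (ratio_test q01).
have rxc : (fun n => `|r n * x|) @ \oo --> `|rho * x|.
  by apply: cvg_norm; apply: cvgMl.
have rxq : \forall n \near \oo, `|r n * x| <= q.
  apply: (cvgr_le _ rxc); rewrite /q; lra.
near=> n.
rewrite /= (near cr n)// exprS.
rewrite (_ : _ * _ * _ = (r n * x) * (c n * x ^+ n)); last by ring.
by rewrite normrM ler_wpM2r// (near rxq n).
Unshelve. all: by end_near. Qed.

Lemma cvg_homographic (a b c d : R) : c != 0 ->
  (fun n : nat => (a * n.+1%:R + b) / (c * n.+1%:R + d)) @ \oo --> a / c.
Proof.
move=> c0.
rewrite (_ : (fun _ => _) =
    (fun n : nat => (a + b * harmonic n) / (c + d * harmonic n))); last first.
  apply/funext => n /=.
  have n0 : n.+1%:R != 0 :> R by rewrite pnatr_eq0.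
  rewrite (_ : a * _ + b = (a + b / n.+1%:R) * n.+1%:R); last by field.
  rewrite (_ : c * _ + d = (c + d / n.+1%:R) * n.+1%:R); last by field.
  by rewrite invfM mulrACA mulfV// mulr1.
have e0 (u v : R) : (fun n : nat => u + v * harmonic n) @ \oo --> u.
  rewrite -[X in _ --> X]addr0 -[X in _ --> _ + X](mulr0 v).
  by apply: cvgD; [exact: cvg_cst|apply: cvgMr; exact: cvg_harmonic].
by apply: cvgM => //; apply: cvgV.
Qed.

Lemma ratio_limit_diffs c rho :
  ratio_limit c rho -> ratio_limit (pseries_diffs c) rho.
Proof.
move=> [r rrho cr].
(* The differentiated series has coefficients [n.+1 * c n.+1], so the ratio gains the factor (n + 2)
   / (n + 1), written in the shape of [cvg_homographic]. *)
exists (fun n => (1 * n.+1%:R + 1) / (1 * n.+1%:R + 0) * r n.+1).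
  have /cvgM := @cvg_homographic 1 1 1 0 (oner_neq0 R).
  rewrite divr1 -[X in _ -> _ --> X]mul1r; apply.
  by rewrite -(cvg_shiftS r) in rrho.
have cr' : \forall n \near \oo, c n.+2 = r n.+1 * c n.+1.
  by case: cr => N _ cr; exists N => // n /= Nn; apply: cr; exact: leqW.
near=> n.
rewrite /pseries_diffs (near cr' n)// -[n.+2%:R]natr1.
have n0 : n.+1%:R != 0 :> R by rewrite pnatr_eq0.
by field.
Unshelve. all: by end_near. Qed.

Definition psum c x : R := limn (pseries c x).

(** Derivatives are two-sided even at an end point of [I]; this is what allows another function to
    be glued there. *)
Definition C2_on (I : set R) (f f1 f2 : R -> R) := forall x, I x ->
  [/\ is_derive x 1 f (f1 x), is_derive x 1 f1 (f2 x) &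
      {for x, continuous f2}].

Lemma is_derive_psum c rho x : 0 < rho -> ratio_limit c rho -> `|rho * x| < 1 ->
  is_derive x 1 (psum c) (psum (pseries_diffs c) x).
Proof.
move=> r0 rc rx1.
(* Termwise differentiation at [x] needs convergence at a point of larger modulus; [K] is halfway to
   the bound [rho^-1]. *)
pose K := (`|x| + rho^-1) / 2.
have xr : `|x| < rho^-1.
  by move: rx1; rewrite normrM (gtr0_norm r0) mulrC -ltr_pdivlMr// div1r.
have K0 : 0 < K by rewrite /K; have := normr_ge0 x; lra.
have rK : `|rho * K| < 1.
  rewrite gtr0_norm; last exact: mulr_gt0.
  by rewrite mulrC -ltr_pdivlMr// div1r /K; lra.
apply: (pseries_snd_diffs (K := K)).
- exact: ratio_limit_cvg rK.
- by apply: ratio_limit_cvg rK; exact: ratio_limit_diffs.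
- by apply: ratio_limit_cvg rK; do 2!apply: ratio_limit_diffs.
- by rewrite (gtr0_norm K0) /K; lra.
Qed.

Lemma psum_C2 c rho : 0 < rho -> ratio_limit c rho ->
  C2_on [set x | `|rho * x| < 1] (psum c) (psum (pseries_diffs c))
    (psum (pseries_diffs (pseries_diffs c))).
Proof.
move=> r0 rc x /= rx; split.
- exact: is_derive_psum rx.
- by apply: is_derive_psum rx => //; exact: ratio_limit_diffs.
- apply: differentiable_continuous; apply/derivable1_diffP.
  apply: ex_derive; apply: is_derive_psum rx => //.
  by do 2!apply: ratio_limit_diffs.
Qed.

Definition antidiffs c : R^nat := fun n => if n is m.+1 then c m / n%:R else 0.

Lemma pseries_diffsK c : pseries_diffs (antidiffs c) = c.
Proof.
apply/funext => n; rewrite /pseries_diffs /antidiffs mulrCA.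
by rewrite mulfV ?mulr1.
Qed.

Lemma ratio_limit_antidiffs c rho :
  ratio_limit c rho -> ratio_limit (antidiffs c) rho.
Proof.
move=> [r rrho cr].
exists (fun n => (1 * n.+1%:R + (-1)) / (1 * n.+1%:R + 0) * r n.-1).
  have /cvgM := @cvg_homographic 1 (-1) 1 0 (oner_neq0 R).
  rewrite divr1 -[X in _ -> _ --> X]mul1r; apply.
  by rewrite -cvg_shiftS.
case: cr => N _ cr; exists N.+1 => // -[//|n] /= Nn.
rewrite cr// -[n.+2%:R]natr1.
have n0 : n.+1%:R != 0 :> R by rewrite pnatr_eq0.
have n1 : n.+1%:R + 1 != 0 :> R by rewrite natr1 pnatr_eq0.
by field; rewrite !nat1r n0 n1.
Qed.

(** Multiplication by [x] shifts the index by one, so the recursion turns each partial sum of the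
    left side, without its constant term, into [x] times a partial sum of the right side. The four
    parameters cover the tube and the cap. *)
Lemma psum_ode c rho (a b e f : R) x : 0 < rho -> ratio_limit c rho ->
  `|rho * x| < 1 ->
  (forall m, (a + b * m.+1%:R) * c m.+1 = (e + f * m%:R) * c m) ->
  a * psum c x + b * x * psum (pseries_diffs c) x - a * c 0
  = x * (e * psum c x + f * x * psum (pseries_diffs c) x).
Proof.
move=> r0 rc rx crec.
have c0 : pseries c x @ \oo --> psum c x by exact: ratio_limit_cvg rx.
have c1 : series (fun i => i%:R * c i * x ^+ i.-1) @ \oo --> psum (pseries_diffs c) x.
  apply: pseries_diffs_equiv; apply: ratio_limit_cvg rx.
  exact: ratio_limit_diffs.
pose V (u v : R) m := (u + v * m%:R) * c m * x ^+ m.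
have cV u v : series (V u v) @ \oo --> u * psum c x + v * x * psum (pseries_diffs c) x.
  rewrite (_ : series _ = (fun n => u * pseries c x n +
      v * x * series (fun i => i%:R * c i * x ^+ i.-1) n)); last first.
    apply/funext => n; rewrite /pseries /series /= !mulr_sumr -big_split/=.
    apply: eq_bigr => -[|i] _; rewrite /V ?expr0/=; first by ring.
    by rewrite exprS; ring.
  by apply: cvgD; apply: cvgMr.
have cS : (fun n => series (V a b) n.+1 - a * c 0) @ \oo -->
    a * psum c x + b * x * psum (pseries_diffs c) x - a * c 0.
  apply: cvgB; last exact: cvg_cst.
  by rewrite (cvg_shiftS (series (V a b))); exact: cV.
have cS' : (fun n => series (V a b) n.+1 - a * c 0) @ \oo -->
    x * (e * psum c x + f * x * psum (pseries_diffs c) x).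
  rewrite (_ : (fun _ => _) = (fun n => x * series (V e f) n)); last first.
    apply/funext => n; rewrite /series/= big_nat_recl// [V a b 0]/V expr0.
    rewrite mulr0 addr0 mulr1 addrAC subrr add0r mulr_sumr.
    by apply: eq_bigr => i _; rewrite /V crec exprS; ring.
  by apply: cvgMr; exact: cV.
by apply: (cvg_unique _ cS cS').
Qed.

End PowerSeries.

(** * Extension of C^2 functions of one variable *)

Section Gluing.
Context {R : realType}.
Implicit Types (f g : R -> R) (x y b : R).

Lemma near_eq_continuous f g x : (\near x, f x = g x) ->
  {for x, continuous f} -> {for x, continuous g}.
Proof.
move=> fg cf; have fgx : f x = g x by exact: nbhs_singleton fg.
apply: cvg_trans (near_eq_cvg fg) _; rewrite -fgx; exact: cf.
Qed.

Definition glue b f g : R -> R := fun y => if y < b then f y else g y.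

Lemma glue_lt b f g x : x < b -> glue b f g x = f x.
Proof. by rewrite /glue => ->. Qed.

Lemma glue_ge b f g x : b <= x -> glue b f g x = g x.
Proof. by rewrite /glue leNgt => /negbTE ->. Qed.

Lemma near_glue_l b f g x : x < b -> \near x, f x = glue b f g x.
Proof.
by move=> xb; near=> y; rewrite /glue ifT//; near: y; exact: lt_nbhsl.
Unshelve. all: by end_near. Qed.

Lemma near_glue_r b f g x : b < x -> \near x, g x = glue b f g x.
Proof.
move=> xb; near=> y; rewrite /glue ifF//; apply/negbTE; rewrite -leNgt.
by apply: ltW; near: y; exact: lt_nbhsr.
Unshelve. all: by end_near. Qed.

Lemma continuous_glue b f g : f b = g b ->
  {for b, continuous f} -> {for b, continuous g} ->
  {for b, continuous (glue b f g)}.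
Proof.
move=> fg cf cg; apply/cvgrPdist_lt => e e0.
have := cf; move=> /cvgrPdist_lt/(_ e e0) nf.
have := cg; move=> /cvgrPdist_lt/(_ e e0) ng.
near=> y; rewrite /glue ltxx; case: ifPn => _.
- by rewrite -fg; near: y.
- by near: y.
Unshelve. all: by end_near. Qed.

(** In the Caratheodory form, differentiability at [b] is continuity at [b] of a slope function, and
    the slope functions of [f] and [g] can themselves be glued. *)
Lemma is_derive_glue b f g d : f b = g b ->
  is_derive b 1 f d -> is_derive b 1 g d -> is_derive b 1 (glue b f g) d.
Proof.
move=> fg /is_derive1_caratheodory[F [fF cF Fb]].
move=> /is_derive1_caratheodory[G [gG cG Gb]].
apply/is_derive1_caratheodory; exists (glue b F G); split.
- move=> z; rewrite /glue ltxx; case: ifPn => _; last exact: gG.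
  by rewrite -fg; exact: fF.
- by apply: continuous_glue => //; rewrite Fb.
- by rewrite /glue ltxx.
Qed.

Lemma C2_glue (I J K : set R) b f f1 f2 g g1 g2 :
  C2_on I f f1 f2 -> C2_on J g g1 g2 ->
  f b = g b -> f1 b = g1 b -> f2 b = g2 b ->
  (forall x, K x -> (x <= b -> I x) /\ (b <= x -> J x)) ->
  C2_on K (glue b f g) (glue b f1 g1) (glue b f2 g2).
Proof.
move=> If Jg fg fg1 fg2 IJ x Kx.
have [ltI geJ] := IJ x Kx.
have [xb|bx|xb] := ltgtP x b.
- have [d1 d2 c] := If x (ltI (ltW xb)); split.
  + rewrite glue_lt//; exact: near_eq_is_derive (near_glue_l _ _ xb) d1.
  + rewrite glue_lt//; exact: near_eq_is_derive (near_glue_l _ _ xb) d2.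
  + by apply: near_eq_continuous c; exact: near_glue_l.
- have [d1 d2 c] := Jg x (geJ (ltW bx)); split.
  + rewrite glue_ge ?ltW//; exact: near_eq_is_derive (near_glue_r _ _ bx) d1.
  + rewrite glue_ge ?ltW//; exact: near_eq_is_derive (near_glue_r _ _ bx) d2.
  + by apply: near_eq_continuous c; exact: near_glue_r.
- subst x.
  have [d1 d2 c] := If b (ltI (lexx b)).
  have [e1 e2 k] := Jg b (geJ (lexx b)).
  split.
  + by rewrite glue_ge//; apply: is_derive_glue => //; rewrite -fg1.
  + by rewrite glue_ge//; apply: is_derive_glue => //; rewrite -fg2.
  + exact: continuous_glue.
Qed.

Definition taylor2 b (u v w : R) : R -> R :=
  fun y => u + v * (y - b) + w * (y - b) ^+ 2 / 2.

Lemma taylor2_C2 b u v w :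
  C2_on setT (taylor2 b u v w) (fun y => v + w * (y - b)) (fun=> w).
Proof.
move=> x _; split; last exact: cvg_cst.
- rewrite /taylor2; apply: is_derive_eq.
  by rewrite /GRing.scale/=; field.
- apply: is_derive_eq.
  by rewrite /GRing.scale/=; ring.
Qed.

(* Outside [a, b] the extension is the second order Taylor polynomial at the
   nearest end point. *)
Lemma C2_extension (I : set R) a b f f1 f2 : a < b ->
  (forall x, a <= x <= b -> I x) -> C2_on I f f1 f2 ->
  exists F F1 F2, C2_on setT F F1 F2 /\
    forall x, a <= x <= b -> [/\ F x = f x, F1 x = f1 x & F2 x = f2 x].
Proof.
move=> ab abI If.
pose ta := taylor2 a (f a) (f1 a) (f2 a).
pose tb := taylor2 b (f b) (f1 b) (f2 b).
exists (glue a ta (glue b f tb)).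
exists (glue a (fun y => f1 a + f2 a * (y - a))
  (glue b f1 (fun y => f1 b + f2 b * (y - b)))).
exists (glue a (fun=> f2 a) (glue b f2 (fun=> f2 b))).
split.
- apply: (C2_glue (I := setT) (J := [set x | a <= x])).
  + exact: taylor2_C2.
  + apply: (C2_glue (I := I) (J := setT)) => //=.
    * exact: taylor2_C2.
    * by rewrite /tb/taylor2; ring.
    * by ring.
    * by move=> x ax; split => // xb; apply: abI; rewrite ax.
  + by rewrite /glue ab /ta/taylor2; ring.
  + by rewrite /glue ab; ring.
  + by rewrite /glue ab.
  + by [].
- move=> x /andP[ax xb]; rewrite /glue (ltNge x a) ax/=.
  case: ltgtP xb => // -> _; split => //.
  + by rewrite /tb/taylor2; ring.
  + by ring.
Qed.

End Gluing.

(** * Radial profiles and their bounds *)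

Section Profiles.
Context {R : realType}.
Implicit Types (z s y r delta : R) (n : nat).

Definition height_laplacian n (h1 h2 : R -> R) z : R :=
  (1 - z ^+ 2) * h2 z - n%:R * z * h1 z.

(* Substituting [h = cst - H (z^2)] for the tube, respectively
   [h = cst - H (1 - z)] for the cap, turns the ODE into a two-term recursion
   on the coefficients of [H'], given here. *)
Fixpoint tube_coeff n m : R :=
  if m is k.+1 then tube_coeff n k * (k.*2.+1 + n)%:R / k.*2.+3%:R else 2^-1.

Lemma tube_coeff_ratio n : ratio_limit (tube_coeff n) 1.
Proof.
exists (fun m => (2 * m.+1%:R + (n%:R - 1)) / (2 * m.+1%:R + 1)).
  rewrite -[X in _ --> X](@mulfV _ (2 : R))//.
  exact: cvg_homographic.
near=> m; rewrite /= -mulrA mulrC; congr (_ / _ * _).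
- by rewrite -!natr1 -addnn !natrD; ring.
- by rewrite -!natr1 -addnn !natrD; ring.
Unshelve. all: by end_near. Qed.

Fixpoint cap_coeff n m : R :=
  if m is k.+1 then cap_coeff n k * (k + n)%:R / (k.*2.+2 + n)%:R else n%:R^-1.

(** The limit 1/2 makes the series in [1 - z] converge at every height above the south pole, in
    particular on the whole cap. *)
Lemma cap_coeff_ratio n : ratio_limit (cap_coeff n) 2^-1.
Proof.
exists (fun m => (1 * m.+1%:R + (n%:R - 1)) / (2 * m.+1%:R + n%:R)).
  rewrite -[X in _ --> X]mul1r.
  exact: cvg_homographic.
near=> m; rewrite /= -mulrA mulrC; congr (_ / _ * _).
- by rewrite -!natr1 !natrD; ring.
- by rewrite natrD -!natr1 -addnn !natrD; ring.
Unshelve. all: by end_near. Qed.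

Lemma cap_coeff_ge0 n m : 0 <= cap_coeff n m.
Proof.
elim: m => [|m IHm] /=; first by rewrite invr_ge0.
by rewrite divr_ge0// mulr_ge0.
Qed.

(** Each factor (k + n) / (2k + 2 + n) is at most 1. Comparison with the geometric series of ratio
    [1 - z] then bounds the derivative of the profile by 1 / (n z), the source of the constant in
    [ball_bound]. *)
Lemma cap_coeff_le n m : cap_coeff n m <= n%:R^-1.
Proof.
elim: m => [|m IHm] //=; apply: le_trans IHm.
rewrite -mulrA ler_piMr ?cap_coeff_ge0// ler_pdivrMr ?ltr0n// mul1r ler_nat.
by rewrite leq_add2r -addnn -!addnS leq_addr.
Qed.

Lemma tube_profile n s : 0 < s < 1 ->
  exists h h1 h2 : R -> R,
  [/\ C2_on setT h h1 h2,
      forall z, `|z| <= s -> height_laplacian n h1 h2 z = -1,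
      (forall z, h (- z) = h z) /\ h1 0 = 0 & h s = 0].
Proof.
move=> /andP[s0 s1].
pose c := tube_coeff n.
have rc : ratio_limit c 1 by exact: tube_coeff_ratio.
have sI : forall x : R, - s ^+ 2 <= x <= s ^+ 2 -> [set x : R | `|1 * x| < 1] x.
  move=> x; rewrite -ler_norml /= mul1r => /le_lt_trans; apply.
  by rewrite expr_lt1// ltW.
have s20 : - s ^+ 2 < s ^+ 2 by rewrite gtrN// exprn_gt0.
have [F [F1 [F2 [FC2 Fc]]]] := C2_extension s20 sI
  (psum_C2 ltr01 (ratio_limit_antidiffs rc)).
rewrite pseries_diffsK in Fc.
exists (fun z => F (s ^+ 2) - F (z ^+ 2)).
exists (fun z => - (2 * z * F1 (z ^+ 2))).
exists (fun z => - (2 * F1 (z ^+ 2) + 4 * z ^+ 2 * F2 (z ^+ 2))).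
have sq z : is_derive z 1 (fun x : R => x ^+ 2) (2 * z).
  apply: is_derive_eq; rewrite /GRing.scale/=; ring.
split.
- move=> z _.
  have [d1 d2 k] := FC2 (z ^+ 2) I.
  have e1 := is_derive1_comp (g := fun x => x ^+ 2) d1 (sq z).
  have e2 := is_derive1_comp (g := fun x => x ^+ 2) d2 (sq z).
  rewrite /comp in e1 e2.
  split.
  + by apply: is_derive_eq; ring.
  + by apply: is_derive_eq; rewrite /GRing.scale/=; ring.
  + have sqc : {for z, continuous (fun x : R => x ^+ 2)}.
      by apply: differentiable_continuous; exact/derivable1_diffP.
    have F1c : {for z, continuous (fun x : R => F1 (x ^+ 2))}.
      by apply: differentiable_continuous; apply/derivable1_diffP; exact: ex_derive.
    have F2c : {for z, continuous (fun x : R => F2 (x ^+ 2))}.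
      by apply: (continuous_comp (f := fun x : R => x ^+ 2)).
    apply: cvgN; apply: cvgD; first exact: cvgMr.
    by apply: cvgM => //; exact: cvgMr.
- move=> z zs; rewrite /height_laplacian.
  have zI : - s ^+ 2 <= z ^+ 2 <= s ^+ 2.
    rewrite -ler_norml ger0_norm ?sqr_ge0//.
    by rewrite -[z ^+ 2]real_normK ?num_real// lerXn2r// nnegrE// ltW.
  have [_ -> ->] := Fc _ zI.
  (* In the variable y = z^2 the ODE reads 2 H' + 4 y H'' - 1 = y ((2 + 2n) H' + 4 y H''), the shape
     of [psum_ode]. *)
  have crec m : (2 + 4 * m.+1%:R) * c m.+1 = (2 + 2 * n%:R + 4 * m%:R) * c m.
    have -> : c m.+1 = c m * (m.*2.+1 + n)%:R / m.*2.+3%:R by [].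
    have m0 : m.*2.+3%:R != 0 :> R by rewrite pnatr_eq0.
    have -> : 2 + 4 * m.+1%:R = 2 * m.*2.+3%:R :> R.
      by rewrite -!natr1 -addnn !natrD; ring.
    rewrite mulrC mulrA -[_ / _ * 2]mulrAC divfK//.
    by rewrite natrD -!natr1 -addnn !natrD; ring.
  have := psum_ode ltr01 rc (sI _ zI) crec.
  rewrite [c 0]/(2^-1) divff//.
  by rewrite !expr2 => e; lra.
- by split => [z|]; rewrite ?sqrrN// mulr0 mul0r oppr0.
- by rewrite subrr.
Qed.

Lemma cap_profile n s : (0 < n)%N -> 0 < s < 1 ->
  exists h h1 h2 : R -> R,
  [/\ C2_on setT h h1 h2,
      forall z, s <= z <= 1 -> height_laplacian n h1 h2 z = -1,
      h s = 0 &
      forall z, s <= z <= 1 -> 0 <= h1 z <= (n%:R * z)^-1].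
Proof.
move=> n0 /andP[s0 s1].
pose c := cap_coeff n.
have nR : n%:R != 0 :> R by rewrite pnatr_eq0 -lt0n.
have rc : ratio_limit c 2^-1 by exact: cap_coeff_ratio.
have h0 : 0 < 2^-1 :> R by [].
have sI : forall x : R, - 1 <= x <= 1 -> [set x : R | `|2^-1 * x| < 1] x.
  by move=> x; rewrite -ler_norml /= normrM gtr0_norm//; lra.
have N11 : - 1 < 1 :> R by lra.
have [F [F1 [F2 [FC2 Fc]]]] := C2_extension N11 sI
  (psum_C2 h0 (ratio_limit_antidiffs rc)).
rewrite pseries_diffsK in Fc.
exists (fun z => F (1 - s) - F (1 - z)).
exists (fun z => F1 (1 - z)).
exists (fun z => - F2 (1 - z)).
have sq z : is_derive z 1 (fun x : R => 1 - x) (- 1).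
  by apply: is_derive_eq; ring.
split.
- move=> z _.
  have [d1 d2 k] := FC2 (1 - z) Logic.I.
  have e1 := is_derive1_comp (g := fun x => 1 - x) d1 (sq z).
  have e2 := is_derive1_comp (g := fun x => 1 - x) d2 (sq z).
  rewrite /comp in e1 e2.
  split.
  + by apply: is_derive_eq; ring.
  + by apply: is_derive_eq; ring.
  + have sqc : {for z, continuous (fun x : R => 1 - x)}.
      by apply: differentiable_continuous; exact/derivable1_diffP.
    by apply: cvgN; apply: (continuous_comp (f := fun x : R => 1 - x)).
- move=> z /andP[sz z1]; rewrite /height_laplacian.
  have zI : - 1 <= 1 - z <= 1 by lra.
  have [_ -> ->] := Fc _ zI.
  (* In the variable y = 1 - z, with 1 - z^2 = y (2 - y), the ODE reads n H' + 2 y H'' - 1 = y (n H'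
     + y H''). *)
  have crec m : (n%:R + 2 * m.+1%:R) * c m.+1 = (n%:R + 1 * m%:R) * c m.
    have -> : c m.+1 = c m * (m + n)%:R / (m.*2.+2 + n)%:R by [].
    have m0 : (m.*2.+2 + n)%:R != 0 :> R by rewrite pnatr_eq0.
    have -> : n%:R + 2 * m.+1%:R = (m.*2.+2 + n)%:R :> R.
      by rewrite natrD -!natr1 -addnn !natrD; ring.
    rewrite mulrC divfK//.
    by rewrite natrD; ring.
  have := psum_ode h0 rc (sI _ zI) crec.
  rewrite [c 0]/(n%:R^-1) mulfV//.
  by rewrite !expr2 => e; lra.
- by rewrite subrr.
- move=> z /andP[sz z1].
  have zI : - 1 <= 1 - z <= 1 by lra.
  have [_ -> _] := Fc _ zI.
  have z0 : 0 < z by lra.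
  have cc : cvgn (pseries c (1 - z)) by apply: ratio_limit_cvg rc _; exact: sI.
  apply/andP; split.
    apply: limr_ge => //; near=> m; apply: sumr_ge0 => i _.
    by rewrite mulr_ge0 ?cap_coeff_ge0// exprn_ge0// subr_ge0.
  have z11 : `|1 - z| < 1 by rewrite ger0_norm; lra.
  have -> : (n%:R * z)^-1 = limn (series (geometric n%:R^-1 (1 - z))).
    apply/esym/cvg_lim => //.
    have := cvg_geometric_series (a := n%:R^-1) z11.
    by rewrite subKr -invfM.
  apply: lim_series_le => //.
    exact: is_cvg_geometric_series.
  move=> m /=; apply: ler_wpM2r; last exact: cap_coeff_le.
  by rewrite exprn_ge0// subr_ge0.
Unshelve. all: by end_near. Qed.

Lemma sin_le_mono r (d : R) : 0 <= r -> r <= d -> d <= pi / 2 -> sin r <= sin d.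
Proof.
move=> r0 rd dp; have p0 := pi_gt0 R.
move: rd; rewrite le_eqVlt => /predU1P[->//|rd].
by rewrite ltW// ltr_sin// in_itv/=; lra.
Qed.

Lemma tube_bound_deltar delta n : tube_bound delta n delta = 0.
Proof. by rewrite /tube_bound subrr !mul0r. Qed.

Lemma tube_bound_ge0 delta n r : 0 < delta < pi / 2 -> 0 <= r <= delta ->
  0 <= tube_bound delta n r.
Proof.
move=> /andP[d0 dp] /andP[r0 rd].
have c0 : 0 <= cos r by apply: cos_ge0_pihalf; lra.
rewrite /tube_bound; apply: mulr_ge0; apply: divr_ge0.
- by rewrite subr_ge0.
- by apply: sin_ge0_pi; lra.
- by rewrite subr_ge0 exprn_ile1// cos_le1.
- by rewrite mulr_ge0// exprn_ge0.
Qed.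

(** With z = sin y in dimension n + 1, the ODE says that - h'(sin y) cos^(n+1) y has derivative
    cos^n y, so the task is to bound the integral of cos^n from below by an explicit function. *)
Lemma tube_profile_ge delta n h h1 h2 : 0 < delta < pi / 2 ->
  C2_on setT h h1 h2 ->
  (forall z, `|z| <= sin delta -> height_laplacian n.+1 h1 h2 z = -1) ->
  h1 0 = 0 -> h (sin delta) = 0 ->
  forall r, 0 <= r <= delta -> tube_bound delta n.+1 r <= h (sin r).
Proof.
move=> /andP[d0 dp] hC2 hL h10 hd.
have sgt0 (x : R) : 0 < x <= delta -> 0 < sin x.
  by move=> /andP[x0 xd]; apply: sin_gt0_pi; lra.
have cgt0 (x : R) : 0 <= x <= delta -> 0 < cos x.
  by move=> /andP[x0 xd]; apply: cos_gt0_pihalf; lra.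
pose A (x : R) : R := - h1 (sin x) * cos x ^+ n.+1.
have dh (x : R) : is_derive x 1 (fun x : R => h (sin x)) (h1 (sin x) * cos x).
  have [e _ _] := hC2 (sin x) Logic.I.
  exact: (is_derive1_comp (g := sin) e (is_derive_sin x)).
have dh1 (x : R) : is_derive x 1 (fun x : R => h1 (sin x)) (h2 (sin x) * cos x).
  have [_ e _] := hC2 (sin x) Logic.I.
  exact: (is_derive1_comp (g := sin) e (is_derive_sin x)).
have Ac (x : R) : 0 < x <= delta -> (1 - cos x ^+ n.+1) / n.+1%:R <= A x * sin x.
  move=> /andP[x0 xd].
  (* As sin x >= sin y on [0, x], sin x times the integral of cos^n dominates the integral of cos^n
     sin, which is (1 - cos^(n+1) x) / (n + 1). Monotonicity of [D] expresses this without
     integrals. *)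
  pose D y := A y * sin x - (1 - cos y ^+ n.+1) / n.+1%:R.
  have dAD (y : R) : is_derive y 1 D (cos y ^+ n * (
     ((- (1 - sin y ^+ 2) * h2 (sin y) + n.+1%:R * sin y * h1 (sin y)) * sin x - sin y))).
    have a1 := dh1 y.
    have a2 : is_derive y 1 (fun y : R => cos y ^+ n.+1)
        (n.+1%:R * cos y ^+ n * - sin y).
      have e : is_derive (cos y) 1 (fun u : R => u ^+ n.+1) (n.+1%:R * cos y ^+ n).
        apply: DeriveDef; first exact: exprn_derivable.
        by rewrite exp_derive /GRing.scale/= mulr1.
      exact: (is_derive1_comp (g := cos) e (is_derive_cos y)).
    rewrite /D /A; apply: is_derive_eq.
    rewrite -cos2sin2 /GRing.scale/= exprS.
    by field; rewrite nat1r pnatr_eq0.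
  have dD (y : R) : y \in `]0, x[%R -> is_derive y 1 D (cos y ^+ n * (sin x - sin y)).
    rewrite in_itv/= => /andP[y0 yx].
    have := hL (sin y); rewrite /height_laplacian.
    have -> : `|sin y| <= sin delta.
      rewrite ger0_norm; first by apply: sin_le_mono; lra.
      by apply: ltW; apply: sgt0; lra.
    move=> /(_ isT) hLy.
    apply: is_derive_eq (dAD y) _; congr (_ * (_ - _)).
    rewrite -[RHS]mul1r; congr (_ * _).
    by apply: oppr_inj; rewrite -[RHS]hLy; ring.
  have [] := @MVT _ D (fun y => cos y ^+ n * (sin x - sin y)) 0 x x0 dD.
    apply: derivable_within_continuous => y _; exact: ex_derive.
  move=> y; rewrite in_itv/= => /andP[y0 yx] Dx.
  have : 0 <= D x - D 0.
    rewrite Dx; do !apply: mulr_ge0.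
    - by rewrite exprn_ge0//; apply: ltW; apply: cgt0; lra.
    - by rewrite subr_ge0; apply: sin_le_mono; lra.
    - by lra.
  rewrite /D {2}/A sin0 h10 oppr0 !mul0r cos0 expr1n subrr mul0r subrr subr0.
  by rewrite subr_ge0.
move=> r /andP[r0]; rewrite le_eqVlt => /predU1P[->|rd].
  by rewrite tube_bound_deltar hd.
have hc : {within `[r, delta], continuous (fun x => h (sin x))}.
  by apply: derivable_within_continuous => x _; have dx := dh x; exact: ex_derive.
(* The mean value point satisfies r < y < delta; replacing it by [r] in both cosines and by [delta]
   in the sine lowers the numerator and raises the denominator, which yields [tube_bound]. *)
have [y] := MVT rd (fun x _ => dh x) hc.
rewrite in_itv/= => /andP[ry yd]; rewrite hd sub0r => /(canRL (@opprK _)) ->.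
have y0 : 0 < y by lra.
have sy : 0 < sin y by apply: sgt0; lra.
have cy : 0 < cos y by apply: cgt0; lra.
have cr : 0 < cos r by apply: cgt0; lra.
have sd : 0 < sin delta by apply: sgt0; lra.
have syd : sin y <= sin delta by apply: sin_le_mono; lra.
have cyr : cos y <= cos r by rewrite ltW// ltr_cos// in_itv/=; lra.
have hy : (1 - cos y ^+ n.+1) / (n.+1%:R * sin y * cos y ^+ n) <= - h1 (sin y) * cos y.
  have := Ac y; rewrite y0 ltW// => /(_ isT).
  rewrite ler_pdivrMr ?ltr0n// ler_pdivrMr; last first.
    by rewrite !mulr_gt0 ?exprn_gt0// ltr0n.
  by move/le_trans; apply; rewrite /A exprS le_eqVlt; apply/orP; left; apply/eqP; ring.
have nd : 1 - cos r ^+ n.+1 <= 1 - cos y ^+ n.+1.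
  by rewrite lerD2l lerN2 lerXn2r// nnegrE ltW.
have nr : 0 <= 1 - cos r ^+ n.+1 by rewrite subr_ge0 exprn_ile1// ?cos_le1// ltW.
have dd : n.+1%:R * sin y * cos y ^+ n <= n.+1%:R * sin delta * cos r ^+ n.
  apply: ler_pM.
  - by rewrite mulr_ge0// ltW.
  - by rewrite exprn_ge0// ltW.
  - by rewrite ler_pM2l// ltr0n.
  - by rewrite lerXn2r// nnegrE ltW.
rewrite -[leRHS]mulNr -mulNr; apply: le_trans (ler_wpM2r _ hy); last by lra.
rewrite /tube_bound/= [leLHS](_ : _ =
  (1 - cos r ^+ n.+1) / (n.+1%:R * sin delta * cos r ^+ n) * (delta - r)); last first.
  by field; rewrite nat1r pnatr_eq0 !gt_eqF ?exprn_gt0.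
apply: ler_wpM2r; first by lra.
apply: ler_pM => //; first by rewrite invr_ge0 !mulr_ge0 ?exprn_ge0 ?ltW.
by rewrite lef_pV2// posrE !mulr_gt0 ?exprn_gt0// ltr0n.
Qed.

End Profiles.

(** * Tangent frames and functions of the height *)

Section Frames.
Context {R : realType} {n : nat}.
Implicit Types (x y e : 'rV[R]_n.+1) (E : 'M[R]_(n, n.+1)).

Lemma dotrE x y : dotr x y = \sum_i x 0 i * y 0 i.
Proof. by rewrite /dotr mxE; apply: eq_bigr => i _; rewrite mxE. Qed.

Lemma dotrC x y : dotr x y = dotr y x.
Proof. by rewrite !dotrE; apply: eq_bigr => i _; rewrite mulrC. Qed.

Lemma dotrDl x y z : dotr (x + y) z = dotr x z + dotr y z.
Proof. by rewrite /dotr mulmxDl mxE. Qed.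

Lemma dotrZl (a : R) x y : dotr (a *: x) y = a * dotr x y.
Proof. by rewrite /dotr -scalemxAl mxE. Qed.

Lemma dotr_eq0 x : dotr x x = 0 -> x = 0.
Proof.
rewrite dotrE => /eqP; rewrite psumr_eq0 => [/allP x0|i _]; last exact: sqr_ge0.
apply/rowP => i; rewrite mxE; apply/eqP.
by have := x0 i (mem_index_enum i); rewrite mulf_eq0 orbb.
Qed.

Lemma dotr_delta x i : dotr x (delta_mx 0 i) = x 0 i.
Proof.
rewrite dotrE (bigD1 i)//= big1 ?addr0 ?mxE ?eqxx ?mulr1// => j ji.
by rewrite mxE eqxx (negbTE ji) mulr0.
Qed.

Lemma sphere_coord_le1 x i : sphere x -> x 0 i ^+ 2 <= 1.
Proof.
rewrite /sphere/= => <-; rewrite dotrE (bigD1 i)//= -expr2 lerDl.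
by apply: sumr_ge0 => j _; rewrite -expr2 sqr_ge0.
Qed.

Lemma sphere_coord_norm x i : sphere x -> `|x 0 i| <= 1.
Proof.
by move=> /(sphere_coord_le1 i); rewrite -[x 0 i ^+ 2]real_normK ?num_real// expr_le1.
Qed.

Lemma frame_row_dot x E i : tangent_frame x E -> sphere x ->
  dotr (row i E) (row i E) = 1 /\ dotr x (row i E) = 0.
Proof.
move=> [EE Ex] sx; split.
- have <- : (E *m E^T) i i = 1 by rewrite EE mxE eqxx.
  by rewrite mxE dotrE; apply: eq_bigr => j _; rewrite !mxE.
- have <- : (E *m x^T) i 0 = 0 by rewrite Ex mxE.
  by rewrite mxE dotrC dotrE; apply: eq_bigr => j _; rewrite !mxE.
Qed.

Lemma sphere_geodesic x e t : sphere x -> dotr e e = 1 -> dotr x e = 0 ->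
  sphere (geodesic x e t).
Proof.
rewrite /sphere/= /geodesic => xx ee xe.
rewrite dotrDl !dotrZl dotrC dotrDl !dotrZl xx (dotrC e x) xe.
rewrite [dotr e _]dotrC dotrDl !dotrZl ee xe.
by rewrite !mulr0 addr0 add0r !mulr1 -!expr2 cos2Dsin2.
Qed.

(** Stacking [x] on [E] gives a square matrix with orthonormal rows; its columns are then
    orthonormal as well, and the i-th column has norm 1. *)
Lemma frame_sum_sqr x E i : sphere x -> tangent_frame x E ->
  \sum_k E k i ^+ 2 = 1 - x 0 i ^+ 2.
Proof.
move=> sx [EE Ex].
have xx : x *m x^T = 1%:M.
  by apply/matrixP => a b; rewrite !ord1 [RHS]mxE eqxx; exact: sx.
have : col_mx x E *m (col_mx x E)^T = 1%:M.
  rewrite tr_col_mx mul_col_row xx EE Ex -[x *m E^T]trmxK trmx_mul trmxK Ex.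
  by rewrite trmx0 -scalar_mx_block.
move=> /mulmx1C; rewrite tr_col_mx mul_row_col => xE.
have <- : (x^T *m x + E^T *m E) i i = 1 by rewrite xE mxE eqxx.
rewrite mxE [(x^T *m x) i i]mxE big_ord1 mxE -expr2 addrAC subrr add0r mxE.
by apply: eq_bigr => k _; rewrite !mxE expr2.
Qed.

Definition householder (v : 'rV[R]_n.+1) : 'M[R]_n.+1 :=
  1%:M - (2 / dotr v v) *: (v^T *m v).

Lemma trmx_householder v : (householder v)^T = householder v.
Proof. by rewrite /householder linearB/= linearZ/= trmx1 trmx_mul trmxK. Qed.

Lemma mul_trmx_dotr x y : x *m y^T = (dotr x y)%:M.
Proof. by apply/matrixP => a b; rewrite !ord1 [RHS]mxE eqxx. Qed.

Lemma householderK v : householder v *m householder v = 1%:M.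
Proof.
rewrite /householder mulmxBl mul1mx mulmxBr mulmx1 -scalemxAl -scalemxAr scalerA.
rewrite mulmxA -(mulmxA _ v) mul_trmx_dotr mul_mx_scalar -scalemxAl scalerA.
have [->|v0] := eqVneq (dotr v v) 0; first by rewrite invr0 mulr0 !mul0r !scale0r !subr0.
by rewrite -[_ * _ * dotr v v]mulrA divfK// mulr_natr mulr2n scalerDl opprB addrK subrK.
Qed.

(* The Householder reflection exchanging e_0 and x has first row x, and its
   other rows are the frame; if x = e_0 then [v = 0] and, since 0^-1 = 0, it is
   the identity. *)
Lemma tangent_frame_exists x : sphere x -> exists E, tangent_frame x E.
Proof.
move=> sx.
pose e0 : 'rV[R]_n.+1 := delta_mx 0 0.
have [v vE] : exists v, v = e0 - x by exists (e0 - x).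
pose H := householder v.
have HT : H^T = H by exact: trmx_householder.
have HH : H *m H = 1%:M by exact: householderK.
have e0H : e0 *m H = x.
  (* This holds because [e0] and [x] are both unit vectors; it makes the reflection subtract exactly
     [v] from [e0]. *)
  have vv : dotr v v = 2 * dotr e0 v.
    have ev : dotr e0 v = 1 - x 0 0.
      rewrite dotrC vE dotrDl -scaleN1r dotrZl !dotr_delta mxE eqxx.
      by rewrite mulN1r.
    have xv : dotr x v = x 0 0 - 1.
      by rewrite dotrC vE dotrDl -scaleN1r dotrZl dotrC dotr_delta sx mulN1r.
    by rewrite {1}vE dotrDl -scaleN1r dotrZl ev xv; ring.
  rewrite /H /householder mulmxBr mulmx1 -scalemxAr mulmxA mul_trmx_dotr.
  rewrite mul_scalar_mx scalerA.
  have [v0|v0] := eqVneq (dotr v v) 0.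
    rewrite v0 invr0 mulr0 mul0r scale0r subr0.
    by move/dotr_eq0/eqP: v0; rewrite vE subr_eq0 => /eqP.
  rewrite mulrAC -vv mulfV// scale1r vE.
  by rewrite opprB addrC subrK.
have HE (i j : 'I_n.+1) : \sum_k H i k * H j k = (i == j)%:R.
  transitivity ((H *m H^T) i j); last by rewrite HT HH mxE.
  by rewrite [RHS]mxE; apply: eq_bigr => k _; rewrite [H^T _ _]mxE.
have H0 k : H 0 k = x 0 k.
  rewrite -e0H [RHS]mxE (bigD1 0)//= big1 ?addr0 => [|j /negbTE j0].
    by rewrite [e0 _ _]mxE eqxx mul1r.
  by rewrite [e0 _ _]mxE j0 andbF mul0r.
exists (row' 0 H); split; apply/matrixP => a b.
- rewrite [LHS]mxE [RHS]mxE -(inj_eq (@lift_inj _ 0)) -HE.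
  by apply: eq_bigr => k _; rewrite [X in X * _]mxE [X in _ * X]mxE [X in _ * X]mxE.
- rewrite ord1 [LHS]mxE [RHS]mxE.
  transitivity ((lift 0 a == 0 :> 'I_n.+1)%:R : R); last by rewrite eq_sym eq_liftF.
  by rewrite -HE; apply: eq_bigr => k _; rewrite [X in X * _]mxE [X in _ * X]mxE H0.
Qed.

End Frames.

Section Height.
Context {R : realType} {n : nat}.
Implicit Types (x y e : 'rV[R]_n.+1) (E : 'M[R]_(n, n.+1)) (h : R -> R).
Local Notation N := (@ord_max n).

Definition height_fun h : 'rV[R]_n.+1 -> R := fun x => h (x 0 N).

Lemma continuous_height_fun h x : {for x 0 N, continuous h} ->
  {for x, continuous (height_fun h)}.
Proof.
by move=> hc; apply: (continuous_comp (f := fun x : 'rV[R]_n.+1 => x 0 N)) => //;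
  exact: coord_continuous.
Qed.

Lemma differentiable_height_fun h x : derivable h (x 0 N) 1 ->
  differentiable (height_fun h) x.
Proof.
move=> /derivable1_diffP dh.
exact: (differentiable_comp (differentiable_coord _ _ _) dh).
Qed.

Lemma partial_height_fun h (h1 : R -> R) (i : 'I_n.+1) : (forall z : R, is_derive z 1 h (h1 z)) ->
  partial i (height_fun h) = height_fun (fun z : R => (i == N)%:R * h1 z).
Proof.
move=> dh; apply/funext => x; rewrite /partial /height_fun.
transitivity ('D_((i == N)%:R) h (x 0 N)).
  rewrite /derive; apply: (f_equal (fun F : R -> R => lim (F t @[t --> 0^'])));
  apply/funext => t /=.
  by rewrite !mxE eqxx/= eq_sym.
case: eqP => _; last by rewrite derive0 mul0r.
by rewrite mul1r; have d := dh (x 0 N); exact: derive_val.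
Qed.

Lemma C2_height_fun (V : set 'rV[R]_n.+1) h h1 h2 :
  C2_on setT h h1 h2 -> C2_euclidean V (height_fun h).
Proof.
move=> hC2 x _.
have dh (z : R) : is_derive z 1 h (h1 z) by have [] := hC2 z Logic.I.
have dh1 i (z : R) : is_derive z 1 (fun z : R => (i == N)%:R * h1 z) ((i == N)%:R * h2 z).
  have [_ d _] := hC2 z Logic.I.
  exact: is_derive_eq.
split.
- by apply: differentiable_height_fun; have d := dh (x 0 N); exact: ex_derive.
- move=> i; rewrite (partial_height_fun i dh).
  by apply: differentiable_height_fun; have d := dh1 i (x 0 N); exact: ex_derive.
- move=> i j; rewrite (partial_height_fun i dh) (partial_height_fun j (dh1 i)).
  apply: continuous_height_fun; do 2!apply: cvgMr.
  by have [] := hC2 (x 0 N) Logic.I.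
Qed.

Lemma derive2_geodesic_height h h1 h2 (z a : R) : C2_on setT h h1 h2 ->
  derive1n 2 (fun t => h (cos t * z + sin t * a)) 0 = h2 z * a ^+ 2 - h1 z * z.
Proof.
move=> hC2.
pose p (t : R) := cos t * z + sin t * a.
have dp (t : R) : is_derive t 1 p (- sin t * z + cos t * a).
  by rewrite /p; apply: is_derive_eq; rewrite /GRing.scale/=; ring.
have dhp (t : R) : is_derive t 1 (fun t => h (p t)) (h1 (p t) * (- sin t * z + cos t * a)).
  by have [d _ _] := hC2 (p t) Logic.I; exact: (is_derive1_comp (g := p) d (dp t)).
have dh1p (t : R) : is_derive t 1 (fun t => h1 (p t)) (h2 (p t) * (- sin t * z + cos t * a)).
  by have [_ d _] := hC2 (p t) Logic.I; exact: (is_derive1_comp (g := p) d (dp t)).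
rewrite /derive1n/=.
have -> : derive1 (fun t => h (p t)) = (fun t => h1 (p t) * (- sin t * z + cos t * a)).
  by apply/funext => t; rewrite derive1E; have d := dhp t; exact: derive_val.
rewrite derive1E.
have d0 := dh1p 0.
have q0 : is_derive (0 : R) 1 (fun t : R => - sin t * z + cos t * a) (- z).
  by apply: is_derive_eq; rewrite /GRing.scale/= sin0 cos0; ring.
have -> : h2 z * a ^+ 2 - h1 z * z = h1 (p 0) * (- z) + (- sin 0 * z + cos 0 * a) * (h2 (p 0) * (- sin 0 * z + cos 0 * a)).
  by rewrite /p sin0 cos0 oppr0 !mul0r !mul1r addr0 add0r; ring.
have d := is_deriveM d0 q0; exact: derive_val.
Qed.

Lemma geodesic_coord x e t i : geodesic x e t 0 i = cos t * x 0 i + sin t * e 0 i.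
Proof. by rewrite /geodesic !mxE. Qed.

Lemma laplacian_height_fun h h1 h2 x : C2_on setT h h1 h2 -> sphere x ->
  has_laplacian (height_fun h) x (height_laplacian n h1 h2 (x 0 N)).
Proof.
move=> hC2 sx E xE.
transitivity (\sum_(i < n) (h2 (x 0 N) * E i N ^+ 2 - h1 (x 0 N) * x 0 N)).
  apply: eq_bigr => i _; rewrite -(derive2_geodesic_height _ _ hC2); congr (derive1n 2 _ 0).
  by apply/funext => t; rewrite /height_fun/= geodesic_coord mxE.
rewrite sumrB -mulr_sumr (frame_sum_sqr _ sx xE) sumr_const card_ord /height_laplacian.
by rewrite -mulr_natl; ring.
Qed.

End Height.

(** * Uniqueness for the Poisson problem *)

Section SecondDerivativeTest.
Context {R : realType}.
Implicit Types (p q : R -> R).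

(** The function [q] is differentiable only at 0, so its slope function there is used: if [d > 0]
    that slope is positive near 0, [q] vanishes at the maximum 0, hence [q > 0] just to the right
    and [p] would exceed [p 0]. *)
Lemma second_derivative_le0 p q (d : R) :
  (\forall t \near (0 : R), is_derive (t : R) 1 p (q t)) -> is_derive (0 : R) 1 q d ->
  (\forall t \near (0 : R), p t <= p 0) -> d <= 0.
Proof.
move=> pd qd pmax; rewrite leNgt; apply/negP => d0.
have /is_derive1_caratheodory[g [qg gc g0]] := qd.
have gpos : \forall t \near (0 : R), 0 < g t.
  by apply: (cvgr_gt _ (gc : g t @[t --> (0 : R)] --> g 0)); rewrite g0.
have [e /= e0 He] : exists2 e : R, 0 < e & forall t, `|t| < e ->
    [/\ is_derive (t : R) 1 p (q t), p t <= p 0 & 0 < g t].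
  have /nbhs_ballP[e e0 He] : \forall t \near (0 : R),
      [/\ is_derive (t : R) 1 p (q t), p t <= p 0 & 0 < g t].
    by near=> t; split; near: t.
  by exists e => // t te; apply: He; rewrite /ball/= sub0r normrN.
pose s := e / 2.
have s0 : 0 < s by rewrite /s; lra.
have inS t : - s <= t <= s -> `|t| < e by rewrite -ler_norml /s => /le_lt_trans; apply; lra.
have q0 : q 0 = 0.
  have [] := @derive1_at_max _ p (- s) s 0.
  - by lra.
  - move=> t; rewrite in_itv/= => /andP[t1 t2].
    by have [] := He t; [apply: inS; lra|move=> dt _ _; exact: ex_derive].
  - by rewrite in_itv/= oppr_lt0 s0.
  - move=> t; rewrite in_itv/= => /andP[t1 t2].
    by have [] := He t; [apply: inS; lra|].
  - move=> _ D0; have [|dt _ _] := He 0; first by rewrite normr0.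
    by rewrite -[RHS]D0; apply/esym; exact: derive_val.
have dS (t : R) : - s <= t <= s -> is_derive t 1 p (q t).
  by move=> /inS /He[].
have dpo (t : R) : t \in `]0, s[%R -> is_derive t 1 p (q t).
  by rewrite in_itv/= => /andP[t1 t2]; apply: dS; lra.
have pc : {within `[0, s], continuous p}.
  apply: derivable_within_continuous => t; rewrite in_itv/= => /andP[t1 t2].
  have dt : is_derive t 1 p (q t) by apply: dS; lra.
  exact: ex_derive.
have [c] := MVT s0 dpo pc.
rewrite in_itv/= => /andP[c0 cs] E.
have [|_ ps _] := He s; first by apply: inS; lra.
have [|_ _ gc0] := He c; first by apply: inS; lra.
have := qg c; rewrite q0 !subr0 => qc.
have : 0 < q c * (s - 0) by rewrite qc !mulr_gt0// subr0.
by rewrite -E; lra.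
Unshelve. all: by end_near. Qed.

End SecondDerivativeTest.

Section Geodesics.
Context {R : realType} {n : nat}.
Implicit Types (x y e : 'rV[R]_n.+1) (E : 'M[R]_(n, n.+1)).

Lemma is_derive_geodesic x e (t : R) :
  is_derive t 1 (geodesic x e) (- sin t *: x + cos t *: e).
Proof.
have dc i j : is_derive t 1 (fun s => geodesic x e s i j)
    (- sin t * x i j + cos t * e i j).
  rewrite (_ : (fun _ => _) = (fun s => cos s * x i j + sin s * e i j)); last first.
    by apply/funext => s; rewrite /geodesic !mxE.
  by apply: is_derive_eq; rewrite /GRing.scale/=; ring.
have dg : derivable (geodesic x e) t 1.
  by apply/derivable_mxP => i j; have d := dc i j; exact: ex_derive.
apply: DeriveDef => //; rewrite derive_mx//; apply/matrixP => i j.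
by rewrite !mxE; have d := dc i j; exact: derive_val.
Qed.

Lemma geodesic0 x e : geodesic x e 0 = x.
Proof. by rewrite /geodesic cos0 sin0 scale1r scale0r addr0. Qed.

Lemma continuous_geodesic x e : continuous (geodesic x e).
Proof.
move=> t; apply: differentiable_continuous; apply/derivable1_diffP.
have d := is_derive_geodesic x e t; exact: ex_derive.
Qed.

Lemma is_derive_comp_geodesic (G : 'rV[R]_n.+1 -> R) x e (t : R) :
  differentiable G (geodesic x e t) ->
  is_derive t 1 (G \o geodesic x e)
    (\sum_i partial i G (geodesic x e t) * (- sin t * x 0 i + cos t * e 0 i)).
Proof.
move=> dG.
have dg := is_derive_geodesic x e t.
have dg' : differentiable (geodesic x e) t by apply/derivable1_diffP; exact: ex_derive.
have dGg : differentiable (G \o geodesic x e) t by exact: differentiable_comp.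
apply: DeriveDef; first exact/derivable1_diffP.
set v : 'rV[R]_n.+1 := - sin t *: x + cos t *: e.
have dv : 'd (geodesic x e) t 1 = v by rewrite -deriveE//; exact: derive_val.
rewrite deriveE// diff_comp//= dv.
rewrite {1}[v]row_sum_delta linear_sum; apply: eq_bigr => i _.
rewrite linearZ/= -deriveE// mulrC; congr (_ * _).
by rewrite /v !mxE.
Qed.

End Geodesics.

Section Uniqueness.
Context {R : realType} {n : nat}.
Implicit Types (x y e : 'rV[R]_n.+1) (E : 'M[R]_(n, n.+1)).
Implicit Types (D Gamma : set 'rV[R]_n.+1).

(** Regularity is available only for a local ambient extension [G]; the geodesic stays on the
    sphere, where [f] and [G] agree, so their compositions with it coincide near 0. *)
Lemma C2_along_geodesic D f x e : C2_sphere D f -> D x -> sphere x ->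
  dotr e e = 1 -> dotr x e = 0 ->
  exists q : R -> R,
    [/\ \forall t \near (0 : R), is_derive (t : R) 1 (f \o geodesic x e) (q t) &
        is_derive (0 : R) 1 q (derive1n 2 (f \o geodesic x e) 0)].
Proof.
move=> fC2 Dx sx ee xe.
have [V [G [oV Vx GC2 fG]]] := fC2 x Dx.
pose q (t : R) := \sum_i partial i G (geodesic x e t) * (- sin t * x 0 i + cos t * e 0 i).
have nV : \forall t \near (0 : R), V (geodesic x e t).
  have := @continuous_geodesic _ _ x e 0; rewrite /continuous_at geodesic0 => gc.
  exact: (gc _ (open_nbhs_nbhs (conj oV Vx))).
have dq : derivable q 0 1.
  rewrite /q [X in derivable X](_ : _ = \sum_i (fun t : R =>
    partial i G (geodesic x e t) * (- sin t * x 0 i + cos t * e 0 i))); last first.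
    by apply/funext => t; rewrite fct_sumE.
  apply: derivable_sum => i; apply: derivableM.
    apply/derivable1_diffP; apply: (differentiable_comp (f := geodesic x e)).
      by apply/derivable1_diffP; have d := is_derive_geodesic x e 0; exact: ex_derive.
    by rewrite geodesic0; have [_ + _] := GC2 _ Vx.
  exact: ex_derive.
have dfq : \forall t \near (0 : R), is_derive (t : R) 1 (f \o geodesic x e) (q t).
  have nnV : \forall t \near (0 : R), \forall s \near t, V (geodesic x e s).
    exact: near_join nV.
  near=> t.
  have Vt : V (geodesic x e t) by near: t.
  have dG : differentiable G (geodesic x e t) by have [] := GC2 _ Vt.
  apply: near_eq_is_derive (is_derive_comp_geodesic dG).
  have : \forall s \near t, V (geodesic x e s) by near: t.
  apply: filterS => s Vs /=; apply/esym/fG => //.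
  exact: sphere_geodesic.
exists q; split => //.
apply: DeriveDef => //; rewrite /derive1n/= derive1E; apply: near_eq_derive.
apply: filterS dfq => t d; rewrite derive1E; apply/esym; exact: derive_val.
Unshelve. all: by end_near. Qed.

(** The second hypothesis is openness of [D] in the sphere: short geodesics from a point of [D] stay
    in [D]. Compactness provides the maximum. *)
Lemma poisson_le D Gamma f g :
  D `<=` sphere -> (forall x, D x -> \forall y \near x, sphere y -> D y) ->
  compact (D `|` Gamma) ->
  poisson_solution D Gamma f -> poisson_solution D Gamma g ->
  forall x, (D `|` Gamma) x -> g x <= f x.
Proof.
move=> Ds Do DGc [fC2 fc fL f0] [gC2 gc gL g0] x DGx.
have key a : 1 < a -> g x <= a * f x.
  move=> a1.
  have qc : {within D `|` Gamma, continuous (fun y => g y - a * f y)}.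
    by move=> y; apply: cvgB; [exact: gc|apply: cvgMr; exact: fc].
  have [c /set_mem DGc' cmax] := EVT_max_rV (ex_intro _ x DGx) DGc qc.
  rewrite -subr_le0; apply: le_trans (cmax x (mem_set DGx)) _.
  case: DGc' => [Dc|Gc]; last by rewrite f0// g0// mulr0 subr0.
  exfalso.
  have sc := Ds _ Dc.
  have [E tE] := tangent_frame_exists sc.
  have [lf /(_ E tE) fE lf1] := fL c Dc.
  have [lg /(_ E tE) gE lg1] := gL c Dc.
  (* The Laplacian of [g - a f] at the maximum equals [a - 1 > 0], yet each second derivative in the
     frame is at most 0. *)
  suff : lg - a * lf <= 0.
    have -> : lf = -1 by lra.
    by lra.
  rewrite -gE -fE mulr_sumr -sumrB; apply: sumr_le0 => i _.
  have [ee xe] := frame_row_dot i tE sc.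
  have [p [dp dp0]] := C2_along_geodesic fC2 Dc sc ee xe.
  have [q [dq dq0]] := C2_along_geodesic gC2 Dc sc ee xe.
  pose w t := g (geodesic c (row i E) t) - a * f (geodesic c (row i E) t).
  apply: (@second_derivative_le0 _ w (fun t => q t - a * p t)).
  - near=> t.
    have d1 : is_derive (t : R) 1 (f \o geodesic c (row i E)) (p t) by near: t.
    have d2 : is_derive (t : R) 1 (g \o geodesic c (row i E)) (q t) by near: t.
    exact: (is_deriveB d2 (is_deriveZ a d1)).
  - have nD : \forall t \near (0 : R), D (geodesic c (row i E) t).
      have := @continuous_geodesic _ _ c (row i E) 0; rewrite /continuous_at geodesic0 => gc0.
      have gcD : \forall t \near (0 : R), sphere (geodesic c (row i E) t) ->
          D (geodesic c (row i E) t) by exact: (gc0 _ (Do c Dc)).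
      apply: filterS gcD => t; apply; exact: sphere_geodesic.
    apply: filterS nD => t Dt; rewrite /w geodesic0.
    by apply: cmax; apply: mem_set; left.
apply/ler_addgt0Pr => eps eps0.
pose b := eps / (`|f x| + 1).
have fx1 : 0 < `|f x| + 1 by have := normr_ge0 (f x); lra.
have b0 : 0 < b by rewrite divr_gt0.
apply: le_trans (key (1 + b) _) _; first by lra.
rewrite mulrDl mul1r lerD2l; apply: le_trans (ler_norm _) _.
rewrite normrM (gtr0_norm b0) /b -mulrA ler_piMr ?ltW// mulrC ltr_pdivrMr// mul1r.
by rewrite ltrDl.
Unshelve. all: by end_near. Qed.

End Uniqueness.

(** * Tubes and caps in terms of the height *)

Section Geometry.
Context {R : realType} {n : nat}.
Implicit Types (x y z : 'rV[R]_n.+1).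
Local Notation N := (@ord_max n).

Lemma dotr_ge0 x : 0 <= dotr x x.
Proof. by rewrite dotrE; apply: sumr_ge0 => i _; rewrite -expr2 sqr_ge0. Qed.

Lemma dotrDr x y z : dotr x (y + z) = dotr x y + dotr x z.
Proof. by rewrite !(dotrC x) dotrDl. Qed.

Lemma dotrZr (a : R) x y : dotr x (a *: y) = a * dotr x y.
Proof. by rewrite !(dotrC x) dotrZl. Qed.

Lemma dotr_Cauchy y z : sphere z -> dotr y z ^+ 2 <= dotr y y.
Proof.
rewrite /sphere/= => sz.
have := dotr_ge0 (y + (- dotr y z) *: z).
rewrite dotrDl dotrZl !dotrDr !dotrZr sz (dotrC z y).
by set a := dotr y z => h; lra.
Qed.

Lemma sphere_north_pole : sphere (north_pole : 'rV[R]_n.+1).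
Proof. by rewrite /sphere/= dotr_delta mxE !eqxx. Qed.

Lemma dotr_sphere_itv x y : sphere x -> sphere y -> -1 <= dotr x y <= 1.
Proof.
move=> sx sy; rewrite -ler_norml -(@expr_le1 _ 2)// real_normK ?num_real//.
by rewrite -[leRHS]sx; exact: dotr_Cauchy.
Qed.

Lemma le_acos (a c : R) : -1 <= a <= 1 -> 0 <= c <= pi -> (c <= acos a) = (a <= cos c).
Proof.
move=> a1 /andP[c0 cp].
have ac : cos (acos a) = a by apply: acosK; rewrite in_itv.
rewrite -{2}ac !leNgt ltr_cos//; rewrite in_itv/=; last by rewrite c0.
by rewrite acos_ge0//= acos_lepi.
Qed.

Lemma asin_itv (a : R) : 0 <= a <= 1 -> 0 <= asin a <= pi / 2 /\ sin (asin a) = a.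
Proof.
move=> /andP[a0 a1].
have [/andP[h1 h2] sa] : - (pi / 2) <= asin a <= pi / 2 /\ sin (asin a) = a.
  by apply: asin_def; lra.
split=> //; rewrite h2 andbT leNgt; apply/negP => dneg.
have : sin (asin a) < sin 0 by rewrite ltr_sin// in_itv/=; lra.
by rewrite sin0 sa; lra.
Qed.

Lemma sdist_north_pole y : sdist y north_pole = acos (y 0 N).
Proof. by rewrite /sdist dotr_delta. Qed.

Lemma sphere_coord_itv x i : sphere x -> -1 <= x 0 i <= 1.
Proof. by move=> sx; rewrite -ler_norml; exact: sphere_coord_norm. Qed.

Lemma geodesic_ballE r : 0 <= r <= pi ->
  geodesic_ball north_pole r = [set y : 'rV[R]_n.+1 | sphere y /\ cos r < y 0 N].
Proof.
move=> r0; rewrite /geodesic_ball /geodesic_sphere; apply/seteqP; split=> y [sy];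
  rewrite /= sdist_north_pole => h; split=> //.
- by rewrite ltNge -le_acos ?sphere_coord_itv// -ltNge.
- by rewrite ltNge le_acos ?sphere_coord_itv// -ltNge.
Qed.

Lemma geodesic_sphereE r : 0 <= r <= pi ->
  geodesic_sphere north_pole r = [set y : 'rV[R]_n.+1 | sphere y /\ y 0 N = cos r].
Proof.
move=> r0; rewrite /geodesic_ball /geodesic_sphere; apply/seteqP; split=> y [sy];
  rewrite /= sdist_north_pole => h; split=> //.
- by rewrite -h acosK// in_itv/= sphere_coord_itv.
- by rewrite h cosK// in_itv.
Qed.

Lemma equatorE : @equator R n = [set z : 'rV[R]_n.+1 | sphere z /\ z 0 N = 0].
Proof.
rewrite /equator; apply/seteqP; split=> z [sz]; rewrite /= sdist_north_pole => h; split=> //.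
- by rewrite -[LHS]acosK ?h ?cos_pihalf// in_itv/= sphere_coord_itv.
- by rewrite h acos0.
Qed.

(** The nearest equatorial point is the normalized projection [y] of [x], and Cauchy-Schwarz shows
    that no other is closer. At a pole the projection vanishes and every equatorial point is at
    distance pi / 2; the first basis vector serves, being on the equator since [n > 0]. *)
Lemma dist_equatorE x : (0 < n)%N -> sphere x -> dist_equator x = asin `|x 0 N|.
Proof.
move=> n0 sx.
have x1 := sphere_coord_norm N sx.
have x0 := normr_ge0 (x 0 N).
have x01 : 0 <= `|x 0 N| <= 1 by rewrite x0.
have [dI sd] := asin_itv x01.
set d := asin `|x 0 N| in dI sd *.
have cd0 : 0 <= cos d by apply: cos_ge0_pihalf; lra.
have dp : 0 <= d <= pi by have := pi_gt0 R; lra.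
have cd : cos d ^+ 2 = 1 - x 0 N ^+ 2.
  by rewrite cos2sin2 sd real_normK ?num_real.
pose y := x - x 0 N *: north_pole.
have pp : dotr (north_pole : 'rV[R]_n.+1) north_pole = 1 := sphere_north_pole.
have yp : dotr y north_pole = 0.
  by rewrite /y -scaleNr dotrDl dotrZl pp dotr_delta mulr1 subrr.
have yx : dotr y x = 1 - x 0 N ^+ 2.
  by rewrite /y -scaleNr dotrDl dotrZl sx dotrC dotr_delta; ring.
have yy : dotr y y = 1 - x 0 N ^+ 2.
  by rewrite {2}/y -scaleNr dotrDr dotrZr yx yp; ring.
pose S := [set sdist x z | z in equator].
have lbS : lbound S d.
  move=> a [z]; rewrite equatorE => -[sz zN] <-; rewrite /sdist le_acos ?dotr_sphere_itv//.
  have -> : dotr x z = dotr y z.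
    by rewrite /y -scaleNr dotrDl dotrZl (dotrC north_pole) dotr_delta zN mulr0 addr0.
  rewrite (le_trans (ler_norm _))// -(@ler_pXn2r _ 2)// ?nnegrE// real_normK ?num_real//.
  by rewrite cd -yy; exact: dotr_Cauchy.
have Sd : S d.
  rewrite /S equatorE.
  have [c0|c0] := eqVneq (cos d) 0.
    have y0 : y = 0 by apply: dotr_eq0; rewrite yy -cd c0 expr0n.
    have zN : (delta_mx 0 0 : 'rV[R]_n.+1) 0 N = 0.
      by rewrite mxE/= -val_eqE/= (gtn_eqF n0).
    exists (delta_mx 0 0); first by split => //; rewrite /sphere/= dotr_delta mxE !eqxx.
    have xE : x = x 0 N *: north_pole by apply/eqP; rewrite -subr_eq0; apply/eqP.
    rewrite /sdist {1}xE dotrZl (dotrC north_pole) dotr_delta zN mulr0.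
    by rewrite -[RHS]cosK ?c0// in_itv.
  exists ((cos d)^-1 *: y).
    split; first by rewrite /sphere/= dotrZl dotrZr yy -cd; field.
    by rewrite mxE -[y 0 N]dotr_delta yp mulr0.
  rewrite /sdist dotrZr (dotrC x y) yx -cd expr2 mulKf// cosK//.
apply/eqP; rewrite eq_le; apply/andP; split.
- by apply: ge_inf => //; exists d.
- by apply: lb_le_inf => //; exists d.
Qed.

Lemma sin_dist_equator x : (0 < n)%N -> sphere x ->
  0 <= dist_equator x <= pi / 2 /\ sin (dist_equator x) = `|x 0 N|.
Proof.
move=> n0 sx; rewrite dist_equatorE//.
by apply: asin_itv; rewrite normr_ge0 sphere_coord_norm.
Qed.

Lemma tubeE (delta : R) : (0 < n)%N -> 0 < delta < pi / 2 ->
  tube delta = [set x : 'rV[R]_n.+1 | sphere x /\ `|x 0 N| <= sin delta].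
Proof.
move=> n0 /andP[d0 dp].
apply/seteqP; split=> x [sx] /= h; split=> //; have [/andP[h1 h2] sE] := sin_dist_equator n0 sx.
- by rewrite -sE; apply: sin_le_mono => //; lra.
- by rewrite leNgt -ltr_sin ?in_itv/= ?sE -?leNgt//; lra.
Qed.

Lemma tube_boundaryE (delta : R) : (0 < n)%N -> 0 < delta < pi / 2 ->
  tube_boundary delta = [set x : 'rV[R]_n.+1 | sphere x /\ `|x 0 N| = sin delta].
Proof.
move=> n0 /andP[d0 dp].
apply/seteqP; split=> x [sx] /= h; split=> //; have [/andP[h1 h2] sE] := sin_dist_equator n0 sx.
- by rewrite -sE h.
- by apply: sin_inj; rewrite ?in_itv/= ?sE//; lra.
Qed.

End Geometry.

(** * Exit of a path sampled along a grid *)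

Section CappedExit.
Context {R : realType}.
Implicit Types (C : set R) (z g : R -> R) (a : nat -> bool) (u : R^nat) (s t T : R).

Definition continuous_ge0 g := forall s, 0 <= s -> forall e : R, 0 < e ->
  exists2 d : R, 0 < d & forall t, 0 <= t -> `|t - s| < d -> `|g t - g s| < e.

Lemma within_continuous_ge0 g : {within `[0, +oo[, continuous g} -> continuous_ge0 g.
Proof.
move=> /subspace_continuousP gc s s0 e e0.
have sI : [set` `[0, +oo[] s by rewrite /= in_itv/= andbT.
have /cvgrPdist_lt/(_ e e0) := gc s sI.
rewrite near_withinE => /nbhs_ballP[d /= d0 dg].
exists d => // t t0 td; rewrite distrC; apply: dg; first by rewrite /ball/= distrC.
by rewrite /= in_itv/= andbT.
Qed.

(** A discrete stochastic integral: an increment counts only while [a] holds. For decreasing [a]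
    this is [g] frozen at the first failure. *)
Definition stopped a u g L : R :=
  g (u 0%N) + \sum_(k < L) (if a k then g (u k.+1) - g (u k) else 0).

Definition alive C z u k : bool := `[< forall j, (j <= k)%N -> C (z (u j)) >].

(** The index [m] is the first sampling index outside [C], or [L]. It does not depend on [g], so all
    stopped values are taken at one common time. *)
Lemma stoppedE C z u L : exists m,
  [/\ (m <= L)%N, forall g, stopped (alive C z u) u g L = g (u m),
      m = L \/ ~ C (z (u m)) & forall j, (j < m)%N -> C (z (u j))].
Proof.
elim: L => [|L [m [mL sE mE Cm]]].
  by exists 0%N; split => // [g|]; [rewrite /stopped big_ord0 addr0|left].
have stoppedS g : stopped (alive C z u) u g L.+1 =
    g (u m) + if alive C z u L then g (u L.+1) - g (u L) else 0.
  by rewrite -sE /stopped big_ord_recr addrA.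
have [CL|nCL] := pselect (C (z (u m))); last first.
  exists m; split => //; [exact: leqW| |by right].
  move=> g; rewrite stoppedS ifF ?addr0//; apply/negP => /asboolP aL.
  by apply: nCL; exact: aL.
have mL' : m = L by case: mE.
subst m; exists L.+1; split => //; [|by left|].
- move=> g; rewrite stoppedS ifT; first by rewrite addrC subrK.
  by apply/asboolP => j; rewrite leq_eqVlt => /predU1P[->|/Cm].
- by move=> j; rewrite ltnS leq_eqVlt => /predU1P[->|/Cm].
Qed.

(* Adding [T] caps the exit time and keeps the set nonempty, as [inf] is
   meaningless on the empty set. *)
Definition capped_exit C z T : R := inf ([set t | 0 < t /\ ~ C (z t)] `|` [set T]).

(** There are [K.+1] steps, so the step is defined for every [K] and time [T] has index [K.+1]. *)
Definition grid T (K k : nat) : R := T * k%:R / K.+1%:R.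

Section Properties.
Variables (C : set R) (z : R -> R) (T : R).
Hypotheses (T0 : 0 < T) (Cc : closed C) (zc : continuous_ge0 z) (Cz0 : C (z 0)).
Let S := [set t | 0 < t /\ ~ C (z t)] `|` [set T].
Let rho := capped_exit C z T.

Let S0 : lbound S 0.
Proof. by move=> t [[/ltW]|->]//; exact: ltW. Qed.

Let ST : S T. Proof. by right. Qed.

Lemma capped_exit_ge0 : 0 <= rho.
Proof. by apply: lb_le_inf => //; exists T. Qed.

Lemma capped_exit_le : rho <= T.
Proof. by apply: ge_inf => //; exists 0. Qed.

Lemma capped_exit_le_out t : 0 < t -> ~ C (z t) -> rho <= t.
Proof. by move=> t0 Ct; apply: ge_inf; [exists 0|left]. Qed.

Lemma before_capped_exit s : 0 <= s -> s < rho -> C (z s).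
Proof.
rewrite le_eqVlt => /predU1P[<-//|s0] srho; apply: contrapT => Cs.
by have := capped_exit_le_out s0 Cs; rewrite leNgt srho.
Qed.

Lemma after_capped_exit e : 0 < e -> rho < T ->
  exists t, [/\ rho <= t, t < rho + e, 0 < t & ~ C (z t)].
Proof.
move=> e0 rT.
(* The margin [T - rho] rules out the artificial element [T], so [t] is a time at which the path is
   outside. *)
have [t St] : exists2 t, S t & t < rho + Num.min e (T - rho).
  apply: inf_adherent; first by rewrite lt_min e0 subr_gt0.
  by split; [exists T|exists 0].
move=> tlt.
have te : t < rho + e by apply: lt_le_trans tlt _; rewrite lerD2l ge_min lexx.
have tT : t < T.
  by apply: lt_le_trans tlt _; rewrite addrC -lerBrDr ge_min lexx orbT.
case: St => [[t0 Ct]|tE]; last by move: tT; rewrite tE ltxx.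
by exists t; split => //; exact: capped_exit_le_out.
Qed.

Lemma at_capped_exit : C (z rho).
Proof.
have := capped_exit_ge0; rewrite le_eqVlt => /predU1P[<-//|r0].
apply: Cc => B /nbhs_ballP[e /= e0 eB].
have [d d0 dz] := zc (ltW r0) e0.
pose s := Num.max 0 (rho - d / 2).
have s0 : 0 <= s by rewrite le_max lexx.
have sr : s < rho by rewrite gt_max r0/=; lra.
exists (z s); split; first exact: before_capped_exit.
apply: eB; rewrite /ball/= distrC; apply: dz => //.
rewrite distrC ger0_norm ?subr_ge0 ?ltW//.
have : rho - d / 2 <= s by rewrite le_max lexx orbT.
by lra.
Qed.

(** There are times outside [C] arbitrarily close to [rho] on the right; together with
    [at_capped_exit] this puts the path on the boundary of [C]. *)
Lemma capped_exit_boundary : rho < T -> closure (~` C) (z rho).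
Proof.
move=> rT B /nbhs_ballP[e /= e0 eB].
have [d d0 dz] := zc capped_exit_ge0 e0.
have [t [rt td t0 Ct]] := after_capped_exit d0 rT.
exists (z t); split => //.
apply: eB; rewrite /ball/= distrC; apply: dz; first exact: ltW.
by rewrite ger0_norm ?subr_ge0//; lra.
Qed.

(** The sampled exit is never before [rho]. If [rho < T], the path is outside [C] at some [t] just
    after [rho], hence on a neighbourhood of [t] since the complement is open, and a fine grid has a
    point there. *)
Lemma stopped_cvg g : continuous_ge0 g ->
  (fun K => stopped (alive C z (grid T K)) (grid T K) g K.+1) @ \oo --> g rho.
Proof.
move=> gc.
have r0 := capped_exit_ge0.
have grid0 K k : (0 < k)%N -> 0 < grid T K k.
  by move=> k0; rewrite /grid divr_gt0// mulr_gt0// ltr0n.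
have gridT K : grid T K K.+1 = T by rewrite /grid mulfK// pnatr_eq0.
apply/cvgrPdist_lt => e e0.
have [d d0 dg] := gc _ r0 _ e0.
have [eta eta0 etaP] : exists2 eta : R, 0 < eta & forall K : nat, T / K.+1%:R < eta ->
    forall m, (m <= K.+1)%N -> m = K.+1 \/ ~ C (z (grid T K m)) ->
    (forall i, (i < m)%N -> C (z (grid T K i))) -> grid T K m < rho + d.
  have := capped_exit_le; rewrite le_eqVlt => /predU1P[rT|rT].
    exists 1 => // K _ m mK _ _.
    apply: (@le_lt_trans _ _ T); last by rewrite -rT ltrDl.
    by rewrite -[leRHS](gridT K) /grid ler_pM2r ?invr_gt0 ?ltr0n// ler_pM2l// ler_nat.
  have d1 : 0 < Num.min d (T - rho) by rewrite lt_min d0 subr_gt0.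
  have [t [rt td t0 Ct]] := after_capped_exit d1 rT.
  have [tr tT] : t < rho + d /\ t < T.
    split; apply: lt_le_trans td _; first by rewrite lerD2l ge_min lexx.
    by rewrite addrC -lerBrDr ge_min lexx orbT.
  have oC : open (~` C) by rewrite openC.
  have [e' e'0 e'C] : exists2 e' : R, 0 < e' & forall y, `|y - z t| < e' -> ~ C y.
    have /nbhs_ballP[e' e'0 e'C] := open_nbhs_nbhs (conj oC (Ct : (~` C) (z t))).
    by exists e' => // y yt; apply: e'C; rewrite /ball/= distrC.
  have [d' d'0 d'z] := zc (ltW t0) e'0.
  exists (Num.min d' t); first by rewrite lt_min d'0.
  move=> K; rewrite lt_min => /andP[Kd' Kt] m mK _ Cm.
  have K0 : 0 < K.+1%:R :> R by rewrite ltr0n.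
  have s0 : 0 < T / K.+1%:R by rewrite divr_gt0.
  (* The last grid point not after [t]: it is within one step of [t], and rounding down keeps it
     below [rho + d]. *)
  pose j := Num.truncn (t / (T / K.+1%:R)).
  have /andP[j1 j2] : j%:R <= t / (T / K.+1%:R) < j.+1%:R.
    by apply: truncn_itv; rewrite divr_ge0// ltW.
  rewrite ler_pdivlMr// in j1; rewrite ltr_pdivrMr// in j2.
  have gj : grid T K j = j%:R * (T / K.+1%:R) by rewrite /grid; ring.
  rewrite -gj in j1.
  have jd : `|grid T K j - t| < d'.
    rewrite distrC ger0_norm ?subr_ge0//; apply: lt_trans Kd'.
    by rewrite gj ltrBlDl; move: j2; rewrite -[j.+1%:R]natr1 mulrDl mul1r.
  have Cj : ~ C (z (grid T K j)).
    apply: e'C; apply: d'z => //.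
    by rewrite /grid divr_ge0// mulr_ge0// ltW.
  have mj : (m <= j)%N by rewrite leqNgt; apply/negP => /Cm.
  apply: le_lt_trans tr; apply: le_trans j1.
  by rewrite /grid ler_pM2r ?invr_gt0// ler_pM2l// ler_nat.
have Tn : \forall K \near \oo, T / K.+1%:R < eta.
  have eT : 0 < eta / T by rewrite divr_gt0.
  have := near_infty_natSinv_lt (PosNum eT); apply: filterS => K /=.
  by rewrite ltr_pdivlMr// mulrC.
apply: filterS Tn => K /etaP Km.
have [m [mK -> mE Cm]] := stoppedE C z (grid T K) K.+1.
have rg : rho <= grid T K m.
  case: (mE) => [->|nC]; first by rewrite gridT; exact: capped_exit_le.
  apply: (capped_exit_le_out _ nC); apply: grid0.
  by rewrite lt0n; apply/eqP => m0; apply: nC; rewrite m0 /grid mulr0 mul0r.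
rewrite distrC; apply: dg; first exact: le_trans rg.
by rewrite ger0_norm ?subr_ge0// ltrBlDl; exact: Km.
Qed.

End Properties.
End CappedExit.

(** * Optional stopping *)

Section PathIntegral.
Context {R : realType}.
Implicit Types (g : R -> R) (s t B : R).
Local Notation mu := (@lebesgue_measure R).

Lemma integrable_path g t : {within `[0, +oo[, continuous g} ->
  mu.-integrable `[0, t] (EFin \o g).
Proof.
move=> gc; apply: continuous_compact_integrable; first exact: segment_compact.
by apply: continuous_subspaceW gc => s /=; rewrite !in_itv/= andbT => /andP[].
Qed.

Lemma Rintegral_path_lipschitz g B s t : {within `[0, +oo[, continuous g} ->
  (forall r, 0 <= r -> `|g r| <= B) -> 0 <= s <= t ->
  `|\int[mu]_(r in `[0, t]) g r - \int[mu]_(r in `[0, s]) g r| <= B * (t - s).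
Proof.
move=> gc gB /andP[s0 st].
have ig := integrable_path t gc.
have sub : `]s, t] `<=` `[0, t].
  by move=> r /=; rewrite !in_itv/= => /andP[/ltW sr ->]; rewrite (le_trans s0).
have ig' : mu.-integrable `]s, t] (EFin \o g) by apply: integrableS ig.
rewrite Rintegral_itvB ?bnd_simp//.
apply: le_trans (le_normr_Rintegral _ ig') _ => //.
apply: (@le_trans _ _ (\int[mu]_(r in `]s, t]) B)).
  apply: le_Rintegral => //.
  - by move: ig' => /integrable_norm.
  - apply: integrableS (@integrable_path (cst B) t _) => //.
    by apply: continuous_subspaceT => r; exact: cst_continuous.
  - by move=> r /sub/=; rewrite in_itv/= => /andP[r0 _]; exact: gB.
rewrite Rintegral_cst//.
rewrite (_ : fine _ = t - s)//.
transitivity (fine (mu [set` `]s, t]])) => //.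
rewrite lebesgue_measure_itv/= lte_fin.
by case: ltgtP st => // -> _; rewrite subrr.
Qed.

Lemma continuous_ge0_Rintegral g B : {within `[0, +oo[, continuous g} ->
  (forall r, 0 <= r -> `|g r| <= B) ->
  continuous_ge0 (fun t => \int[mu]_(r in `[0, t]) g r).
Proof.
move=> gc gB s s0 e e0.
have B0 : 0 <= B by apply: le_trans (gB 0 (lexx 0)).
exists (e / (B + 1)); first by rewrite divr_gt0// ltr_wpDl.
have key r t : 0 <= r <= t -> `|t - r| < e / (B + 1) ->
    `|\int[mu]_(r in `[0, t]) g r - \int[mu]_(x in `[0, r]) g x| < e.
  move=> /andP[r0 rt] h.
  rewrite ger0_norm ?subr_ge0// ltr_pdivlMr ?ltr_wpDl// in h.
  apply: le_lt_trans (Rintegral_path_lipschitz gc gB _) _; first by rewrite r0.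
  by apply: le_lt_trans h; rewrite mulrC ler_wpM2l ?subr_ge0// lerDl.
move=> t t0 td; have [st|ts] := leP s t; first by apply: key => //; rewrite s0.
by rewrite distrC; apply: key; rewrite ?t0 ?ltW// distrC.
Qed.

Lemma Rintegral_path_cst g c t : {within `[0, +oo[, continuous g} -> 0 <= t ->
  (forall r, 0 <= r < t -> g r = c) -> \int[mu]_(r in `[0, t]) g r = c * t.
Proof.
move=> gc t0 gC.
rewrite -Rintegral_itv_bndo_bndc; last first.
  apply: integrableS (integrable_path t gc) => //.
  by move=> r /=; rewrite !in_itv/= => /andP[-> /ltW].
rewrite (@eq_Rintegral _ _ _ mu _ (fun=> c)); last first.
  by move=> r; rewrite inE/= in_itv/= => /gC.
rewrite Rintegral_cst//.
rewrite (_ : fine _ = t)//.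
transitivity (fine (mu [set` `[0, t[])) => //.
rewrite lebesgue_measure_itv/= lte_fin.
by case: ltgtP t0 => //= _ _; rewrite subr0.
Qed.

End PathIntegral.

Section IntegralMonotone.
Context {R : realType} {d : measure_display} {W : measurableType d}.
Variable P : {measure set W -> \bar R}.

(* No measurability is needed, since the integral of a nonnegative function is
   defined as a supremum over the simple functions below it. *)
Lemma ge0_le_integral_nonmeasurable (f g : W -> \bar R) :
  (forall w, 0 <= f w)%E -> (forall w, f w <= g w)%E ->
  (\int[P]_w f w <= \int[P]_w g w)%E.
Proof.
move=> f0 fg.
have g0 w : (0 <= g w)%E by exact: le_trans (fg w).
rewrite !ge0_integralTE//; apply: le_ereal_sup => _ [k kf <-].
by exists k => // w; exact: le_trans (fg w).
Qed.

End IntegralMonotone.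

Section OptionalStopping.
Context {R : realType} {d : measure_display} {W : measurableType d}.
Variable P : probability W R.

(** The increment from [u k] to [u k.+1] has integral zero over [A k], because [A k] is decided at
    time [u k]; the sum then telescopes in expectation. *)
Lemma martingale_stopped (F : R -> set (set W)) (M : R -> W -> R)
    (A : nat -> set W) (u : R^nat) L :
  martingale P F M ->
  (forall t B, 0 <= t -> F t B -> measurable B) ->
  (forall k, F (u k) (A k)) -> (forall k, 0 <= u k <= u k.+1) ->
  P.-integrable setT (fun w => (stopped (fun k => w \in A k) u (M^~ w) L)%:E) /\
  (\int[P]_w (stopped (fun k => w \in A k) u (M^~ w) L)%:E
    = \int[P]_w (M (u 0%N) w)%:E)%E.
Proof.
move=> [_ Mi Mm] FW FA u0.
have u0' k : 0 <= u k by have /andP[] := u0 k.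
elim: L => [|L [IHi IHe]].
  have S0 : (fun w => (stopped (fun k => w \in A k) u (M^~ w) 0)%:E) = EFin \o M (u 0%N).
    by apply/funext => w; rewrite /stopped big_ord0 addr0.
  by split; rewrite S0//; exact: Mi.
pose D (w : W) : R := M (u L.+1) w - M (u L) w.
have SE w : ((stopped (fun k => w \in A k) u (M^~ w) L.+1)%:E =
    (stopped (fun k => w \in A k) u (M^~ w) L)%:E + ((EFin \o D) \_ (A L)) w)%E.
  rewrite /stopped big_ord_recr/= addrA EFinD patchE; congr (_ + _)%E.
  by case: ifP.
have mA : measurable (A L) by exact: FW (FA L).
have Di : P.-integrable setT (EFin \o D).
  rewrite (_ : EFin \o D = (EFin \o M (u L.+1)) \- (EFin \o M (u L)))%E; last first.
    by apply/funext => w; rewrite /= EFinB.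
  by apply: integrableB => //; exact: Mi.
have DAi : P.-integrable setT ((EFin \o D) \_ (A L)).
  by apply/(integrable_mkcond _ mA); apply: integrableS Di.
have DA0 : (\int[P]_w ((EFin \o D) \_ (A L)) w = 0)%E.
  rewrite -integral_mkcond.
  under eq_integral do rewrite /= EFinB.
  rewrite integralB_EFin//; last 2 first.
  - by apply: integrableS (Mi _ (u0' _)).
  - by apply: integrableS (Mi _ (u0' _)).
  rewrite (Mm (u L))//; last by have /andP[] := u0 L.
  rewrite subee//; apply: integrable_fin_num => //.
  by apply: integrableS (Mi _ (u0' _)).
split.
- have -> := funext SE; exact: integrableD.
- under eq_integral do rewrite SE.
  by rewrite integralD// DA0 adde0.
Qed.

End OptionalStopping.

Section NaturalFiltration.
Context {R : realType} {n : nat} {d : measure_display} {W : measurableType d}.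
Variables (X : R -> W -> 'rV[R]_n.+1).
Hypothesis Xm : forall t, 0 <= t -> forall i, measurable_fun setT (fun w => X t w 0 i : R).

Lemma natural_filtration_measurable t B : natural_filtration X t B -> measurable B.
Proof.
apply: smallest_sub; first exact: sigma_algebra_measurable.
move=> A [r [i [C [/andP[r0 _] mC ->]]]].
by rewrite -[X in measurable X]setTI; exact: Xm.
Qed.

Lemma natural_filtration_alive (C : set R) (u : R^nat) i k : measurable C ->
  (forall j, (j <= k)%N -> 0 <= u j <= u k) ->
  natural_filtration X (u k) [set w | forall j, (j <= k)%N -> C (X (u j) w 0 i)].
Proof.
move=> mC u0.
set G := [set A | exists r i (B : set R),
  [/\ 0 <= r <= u k, measurable B & A = [set w | B (X r w 0 i)]]].
rewrite (_ : [set w | _] = \bigcap_(j in `I_k.+1) [set w | C (X (u j) w 0 i)]); last first.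
  by apply/seteqP; split => w /= h j; exact: h.
apply: (@bigcap_measurable _ (g_sigma_algebraType G)); first by exists 0%N.
move=> j jk; apply: sub_sigma_algebra; exists (u j), i, C; split => //.
exact: u0.
Qed.

End NaturalFiltration.

(** * Expected exit time of Brownian motion from a closed set of heights *)

Section BrownianExit.
Context {R : realType} {n : nat} {d : measure_display} {W : measurableType d}.
Local Notation N := (@ord_max n).
Local Notation mu := (@lebesgue_measure R).
Implicit Types (T t s B : R) (K L : nat) (w : W) (g : R -> R).
Variables (P : probability W R) (x : 'rV[R]_n.+1) (X : R -> W -> 'rV[R]_n.+1).
Hypothesis XB : brownian_motion P x X.
Variables (C : set R) (h h1 h2 : R -> R).
Hypotheses (Cc : closed C) (Cx : C (x 0 N)) (hC2 : C2_on setT h h1 h2).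
Hypothesis hL : forall z, C z -> `|z| <= 1 -> height_laplacian n h1 h2 z = -1.
Hypothesis h0 : forall z, C z -> `|z| <= 1 -> 0 <= h z.
Hypothesis hb : forall z, C z -> closure (~` C) z -> `|z| <= 1 -> h z = 0.

Let z (w : W) (s : R) : R := X s w 0 N.
Let LL : R -> R := height_laplacian n h1 h2.
Let M t w := h (z w t) - h (z w 0) - \int[mu]_(s in `[0, t]) LL (z w s).
Let rho T w := capped_exit C (z w) T.

Let z1 (w : W) (s : R) : 0 <= s -> `|z w s| <= 1.
Proof. by case: XB => _ _ Xs _ _ s0; apply: sphere_coord_norm; exact: Xs. Qed.

Let zc w : {within `[0, +oo[, continuous (z w)}.
Proof.
case: XB => _ _ _ Xc _ s.
apply: (@cvg_comp _ _ _ (fun s => X s w) (fun y : 'rV[R]_n.+1 => y 0 N)).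
  exact: Xc.
exact: coord_continuous.
Qed.

Let z0 w : z w 0 = x 0 N.
Proof. by case: XB => _ X0 _ _ _; rewrite /z X0. Qed.

Let hc : continuous h.
Proof.
move=> y; have [dh _ _] := @hC2 y Logic.I.
by apply: differentiable_continuous; apply/derivable1_diffP; exact: ex_derive.
Qed.

Let LLc : continuous LL.
Proof.
move=> y; have [_ dh1 h2c] := @hC2 y Logic.I.
have h1c : {for y, continuous h1}.
  by apply: differentiable_continuous; apply/derivable1_diffP; exact: ex_derive.
have idc : (fun y : R => y) @ y --> y by exact: cvg_id.
rewrite /LL /height_laplacian; apply: cvgB; apply: cvgM => //.
- by apply: cvgB; [exact: cvg_cst|apply: cvgM].
- by apply: cvgM => //; exact: cvg_cst.
Qed.

Let path_comp (g : R -> R) w : continuous g ->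
  {within `[0, +oo[, continuous (fun s => g (z w s))}.
Proof. by move=> gc s; apply: (@cvg_comp _ _ _ (z w) g); [exact: zc|exact: gc]. Qed.

Let M_martingale : martingale P (natural_filtration X) M.
Proof.
case: XB => _ _ _ _ /(_ (height_fun h) (fun y => LL (y 0 N))); apply.
  move=> y _; exists setT, (height_fun h); split => //; first exact: openT.
  exact: C2_height_fun hC2.
by move=> y sy; exact: laplacian_height_fun.
Qed.

Let bound : exists2 B : R, 0 < B & forall y, `|y| <= 1 -> `|h y| <= B /\ `|LL y| <= B.
Proof.
have bd (g : R -> R) : continuous g -> exists2 B : R, 0 < B & forall y, `|y| <= 1 -> `|g y| <= B.
  move=> gc.
  have gn : {within `[-1, 1], continuous (fun y => `|g y|)}.
    by apply: continuous_subspaceT => y; apply: cvg_norm; exact: gc.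
  have N11 : -1 <= 1 :> R by lra.
  have [c _ cmax] := EVT_max N11 gn.
  exists (`|g c| + 1); first by have := normr_ge0 (g c); lra.
  move=> y y1; apply: le_trans (cmax y _) _; last by rewrite lerDl.
  by rewrite in_itv/= -ler_norml.
have [B1 B10 hB1] := bd _ hc; have [B2 B20 hB2] := bd _ LLc.
exists (B1 + B2); first by lra.
move=> y y1; split.
- by apply: le_trans (hB1 y y1) _; lra.
- by apply: le_trans (hB2 y y1) _; lra.
Qed.

Let M_continuous w : continuous_ge0 (M^~ w).
Proof.
have [B B0 hB] := bound.
have c1 := within_continuous_ge0 (path_comp (w:=w) hc).
have c2 : continuous_ge0 (fun t => \int[mu]_(s in `[0, t]) LL (z w s)).
  apply: (@continuous_ge0_Rintegral _ _ B); first exact: path_comp.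
  by move=> r r0; have [] := hB _ (z1 w r0).
move=> s s0 e e0; have e20 : 0 < e / 2 by lra.
have [d1 d10 h1'] := c1 s s0 _ e20; have [d2 d20 h2'] := c2 s s0 _ e20.
exists (Num.min d1 d2); first by rewrite lt_min d10.
move=> t t0; rewrite lt_min => /andP[td1 td2]; rewrite /M.
have := h1' t t0 td1; have := h2' t t0 td2.
set I1 := \int[mu]_(_ in _) _; set I2 := \int[mu]_(_ in _) _.
rewrite !ltr_norml => /andP[a1 a2] /andP[a3 a4]; apply/andP; split; lra.
Qed.

Let M_bound w t T B : (forall y, `|y| <= 1 -> `|h y| <= B /\ `|LL y| <= B) ->
  0 <= t <= T -> `|M t w| <= 2 * B + B * T.
Proof.
move=> hB /andP[t0 tT].
have B0 : 0 <= B by have [/(le_trans (normr_ge0 _))] := hB 0 ltac:(by rewrite normr0).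
have I0 : \int[mu]_(s in `[0, 0]) LL (z w s) = 0 by rewrite set_itv1 Rintegral_set1.
have := @Rintegral_path_lipschitz _ (fun s => LL (z w s)) B 0 t (path_comp (w:=w) LLc) _ _.
rewrite I0 !subr0 => /(_ (fun r r0 => (hB _ (z1 w r0)).2)).
rewrite lexx => /(_ t0) It.
have [h_t _] := hB _ (z1 w t0); have [h_0 _] := hB _ (z1 w (lexx 0)).
apply: le_trans (ler_normB _ _) _; apply: lerD.
  by apply: le_trans (ler_normB _ _) _; lra.
by apply: le_trans It _; rewrite ler_wpM2l.
Qed.

Let A T K (k : nat) : set W := [set w | forall j, (j <= k)%N -> C (X (grid T K j) w 0 N)].

Let grid_le T K (j k : nat) : 0 < T -> (j <= k)%N -> 0 <= grid T K j <= grid T K k.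
Proof.
move=> T0 jk; rewrite /grid; apply/andP; split.
  by rewrite divr_ge0// mulr_ge0// ltW.
by rewrite ler_pM2r ?invr_gt0 ?ltr0n// ler_pM2l// ler_nat.
Qed.

Let A_adapted T K k : 0 < T -> natural_filtration X (grid T K k) (A T K k).
Proof.
move=> T0; apply: natural_filtration_alive; first exact: closed_measurable.
by move=> j; exact: grid_le.
Qed.

Let A_measurable T K k : 0 < T -> measurable (A T K k).
Proof.
case: XB => Xm _ _ _ _ T0.
apply: (@natural_filtration_measurable _ _ _ _ X Xm (grid T K k)); exact: A_adapted.
Qed.

(** Membership in [A] and [alive] are convertible, which links the measure-theoretic and the
    pathwise statements on stopping. *)
Let stopped_A T K g w L :
  stopped (fun k => w \in A T K k) (grid T K) g L =
  stopped (alive C (z w) (grid T K)) (grid T K) g L.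
Proof.
by [].
Qed.

(** With the identity for [g], the stopped sums are the sampled exit times: finite combinations of
    indicators, converging pointwise to [rho]. *)
Let rho_measurable T : 0 < T -> measurable_fun setT (rho T).
Proof.
move=> T0.
apply: (@measurable_fun_cvg _ _ _ _ (fun K w =>
    stopped (fun k => w \in A T K k) (grid T K) id K.+1)); last first.
  move=> w _; under eq_fun do rewrite stopped_A.
  apply: (@stopped_cvg R C (z w) T _ _ _ _ id) => //.
  - exact: within_continuous_ge0.
  - by rewrite z0.
  - by move=> s s0 e e0; exists e.
move=> K; apply: measurable_funD; first exact: measurable_cst.
apply: measurable_sum => k.
rewrite (_ : (fun w => _) = (fun w => \1_(A T K k) w * (grid T K k.+1 - grid T K k))).
  by apply: measurable_funM => //; apply: measurable_indic; exact: A_measurable.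
by apply/funext => w; rewrite indicE; case: ifP => _; rewrite ?mul1r ?mul0r.
Qed.

Let rho_itv T w : 0 < T -> 0 <= rho T w <= T.
Proof. by move=> T0; rewrite capped_exit_ge0//= capped_exit_le. Qed.

(** The stopped sums have the mean of [M 0], which is 0, and the cap [T] bounds them uniformly, so
    dominated convergence applies as the grid is refined. *)
Let integral_M_rho T : 0 < T ->
  P.-integrable setT (fun w => (M (rho T w) w)%:E) /\
  (\int[P]_w (M (rho T w) w)%:E = 0)%E.
Proof.
move=> T0.
have [B B0 hB] := bound.
case: (XB) => Xm _ _ _ _.
have FW t A' : 0 <= t -> natural_filtration X t A' -> measurable A'.
  by move=> _; exact: natural_filtration_measurable.
have st K := @martingale_stopped _ _ _ P (natural_filtration X) M (A T K) (grid T K) K.+1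
  M_martingale FW (fun k => @A_adapted T K k T0) (fun k => @grid_le T K k k.+1 T0 (leqnSn k)).
pose S K w := stopped (fun k => w \in A T K k) (grid T K) (M^~ w) K.+1.
have cS w : S ^~ w @ \oo --> M (rho T w) w.
  rewrite /S; under eq_fun do rewrite stopped_A.
  apply: (@stopped_cvg R C (z w) T _ _ _ _ (M^~ w)) => //.
  - exact: within_continuous_ge0.
  - by rewrite z0.
have Sm K : measurable_fun setT (EFin \o S K).
  by have [i _] := st K; exact: measurable_int i.
have Sb K w : `|S K w| <= 2 * B + B * T.
  rewrite /S stopped_A; have [m [mK -> _ _]] := stoppedE C (z w) (grid T K) K.+1.
  apply: M_bound => //.
  have gT : grid T K K.+1 = T by rewrite /grid mulfK// pnatr_eq0.
  by have := @grid_le T K _ _ T0 mK; rewrite gT.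
have S0 K : (\int[P]_w (S K w)%:E = 0)%E.
  have [_ ->] := st K.
  rewrite (_ : grid T K 0 = 0); last by rewrite /grid mulr0 mul0r.
  rewrite (eq_integral (cst 0%E)) ?integral0// => w _.
  by rewrite /M subrr set_itv1 Rintegral_set1 subr0.
have [] := @dominated_convergence _ _ _ P setT measurableT (fun K => EFin \o S K)
  (fun w => (M (rho T w) w)%:E) (cst (2 * B + B * T)%:E).
- exact: Sm.
- apply/measurable_EFinP; apply: (@measurable_fun_cvg _ _ _ _ S) => [K|w _].
    by apply/measurable_EFinP; exact: Sm.
  exact: cS.
- by apply: aeW => w _; apply: cvg_EFin; [exact: nearW|exact: cS].
- exact: finite_measure_integrable_cst.
- by apply: aeW => w K _; rewrite /= lee_fin.
move=> ir _ /=; under eq_fun do rewrite S0.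
by move=> c0; split => //; apply: (cvg_unique _ c0) => //; exact: cvg_cst.
Qed.

(** Before [rho] the path is in [C], where the integrand is -1, so the integral term contributes
    [+ rho]. *)
Let M_rho T w : 0 < T -> M (rho T w) w = h (z w (rho T w)) + rho T w - h (x 0 N).
Proof.
move=> T0; have /andP[r0 rT] := rho_itv w T0.
rewrite /M z0 (@Rintegral_path_cst _ _ (-1)) ?mulN1r; first by ring.
- exact: path_comp.
- by [].
- move=> s /andP[s0 sr]; apply: hL; last exact: z1.
  by apply: (before_capped_exit _ _ s0 sr) => //; rewrite z0.
Qed.

Let h_rho_ge0 T w : 0 < T -> 0 <= h (z w (rho T w)).
Proof.
move=> T0; have /andP[r0 rT] := rho_itv w T0.
apply: h0; last exact: z1.
apply: at_capped_exit => //; first exact: within_continuous_ge0.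
by rewrite z0.
Qed.

(** One bound for two cases: if [rho = T] the right side is [B]; if [rho < T] the path is on the
    boundary of [C] and the left side is 0. *)
Let h_rho_le B T w : 0 < T -> (forall y, `|y| <= 1 -> `|h y| <= B /\ `|LL y| <= B) ->
  h (z w (rho T w)) <= B / T * rho T w.
Proof.
move=> T0 hB; have /andP[r0] := rho_itv w T0.
rewrite le_eqVlt => /predU1P[->|rT].
  rewrite divfK ?gt_eqF//; apply: le_trans (ler_norm _) _.
  by have [] := hB _ (z1 w (ltW T0)).
have B0 : 0 <= B by have [/(le_trans (normr_ge0 _))] := hB 0 ltac:(by rewrite normr0).
have -> : h (z w (rho T w)) = 0.
  apply: hb; last exact: z1.
  - apply: at_capped_exit => //; first exact: within_continuous_ge0.
    by rewrite z0.
  - by apply: capped_exit_boundary => //; exact: within_continuous_ge0.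
by rewrite mulr_ge0// divr_ge0// ltW.
Qed.

Let integral_rho T : 0 < T -> (\int[P]_w (rho T w)%:E <= (h (x 0 N))%:E)%E /\
  forall B, (forall y, `|y| <= 1 -> `|h y| <= B /\ `|LL y| <= B) ->
  ((h (x 0 N))%:E <= (1 + B / T)%:E * \int[P]_w (rho T w)%:E)%E.
Proof.
move=> T0; have [Mi M0] := integral_M_rho T0.
pose Y w : R := h (z w (rho T w)) + rho T w.
have rm : measurable_fun setT (EFin \o rho T).
  by apply/measurable_EFinP; exact: rho_measurable.
have r0 w : 0 <= rho T w by have /andP[] := rho_itv w T0.
have YE : (fun w => (Y w)%:E) =
    ((fun w => (M (rho T w) w)%:E) \+ (EFin \o cst (h (x 0 N))%R))%E.
  by apply/funext => w; rewrite /= M_rho// -EFinD subrK.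
have ic : P.-integrable setT (EFin \o cst (h (x 0 N))).
  exact: finite_measure_integrable_cst.
have Ym : measurable_fun setT (fun w => (Y w)%:E).
  by rewrite YE; apply: (measurable_int P); exact: integrableD.
have EY : (\int[P]_w (Y w)%:E = (h (x 0 N))%:E)%E.
  rewrite YE integralD// M0 add0e.
  rewrite (eq_integral (cst (h (x 0 N))%:E))//.
  by rewrite integral_cst//= probability_setT mule1.
rewrite -EY; split.
  by apply: ge0_le_integral => // w _; rewrite lee_fin ?r0// /Y lerDr h_rho_ge0.
move=> B hB.
have B0 : 0 <= B by have [/(le_trans (normr_ge0 _))] := hB 0 ltac:(by rewrite normr0).
have BT : 0 <= 1 + B / T by rewrite addr_ge0// divr_ge0// ltW.
rewrite -ge0_integralZl_EFin//; last by move=> w _; rewrite lee_fin r0.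
apply: ge0_le_integral => //.
- by move=> w _; rewrite lee_fin /Y addr_ge0 ?r0 ?h_rho_ge0.
- by apply: measurable_funeM.
- move=> w _; rewrite -EFinM lee_fin /Y mulrDl mul1r addrC lerD2l.
  exact: h_rho_le.
Qed.

Section ExitTime.
Variable Omega : set 'rV[R]_n.+1.
Hypothesis OmegaC : forall y, sphere y -> Omega y <-> C (y 0 N).
Let tau := exit_time X Omega.

Let outE w t : 0 < t -> ~ Omega (X t w) <-> ~ C (z w t).
Proof.
case: XB => _ _ Xs _ _ t0; have [OC CO] := OmegaC (Xs t w (ltW t0)).
by split => nO; [move/CO|move/OC].
Qed.

Let tau_le w t : 0 < t -> ~ C (z w t) -> (tau w <= t%:E)%E.
Proof.
by move=> t0 nC; apply: ereal_inf_lbound; exists t => //; split => //; apply/outE.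
Qed.

Let rho_le_tau T w : 0 < T -> ((rho T w)%:E <= tau w)%E.
Proof.
move=> T0; apply: le_ereal_inf_tmp => _ [t [t0 nO] <-].
by rewrite lee_fin; apply: capped_exit_le_out => //; apply/outE.
Qed.

(** For a cap larger than [a] the capped time lies strictly below the cap, hence comes from actual
    exits. *)
Let tau_le_of w (a : R) : (forall k : nat, rho k.+1%:R w <= a) -> (tau w <= a%:E)%E.
Proof.
move=> ra; apply/lee_addgt0Pr => e e0.
have a0 : 0 <= a.
  apply: le_trans (ra 0%N).
  by have /andP[] : 0 <= rho 1%:R w <= 1%:R by exact: rho_itv.
pose k := Num.truncn a.
have ak : a < k.+1%:R by have /andP[] := truncn_itv a0.
have k0 : 0 < k.+1%:R :> R by rewrite ltr0n.
have [t [_ tr t0 nC]] := @after_capped_exit _ C (z w) _ k0 e e0 (le_lt_trans (ra k) ak).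
apply: le_trans (tau_le t0 nC) _.
rewrite -EFinD lee_fin; apply: le_trans (ltW tr) _.
by rewrite lerD2r; exact: ra.
Qed.

Let tau_ge0 w : (0 <= tau w)%E.
Proof.
apply: le_trans (rho_le_tau w ltr01); rewrite lee_fin.
by have /andP[] := rho_itv w ltr01.
Qed.

Let rho_nd w : nondecreasing_seq (fun k : nat => (rho k.+1%:R w)%:E).
Proof.
move=> k l kl; rewrite lee_fin.
have l0 : 0 < l.+1%:R :> R by rewrite ltr0n.
have k0 : 0 < k.+1%:R :> R by rewrite ltr0n.
apply: lb_le_inf; first by exists l.+1%:R; right.
move=> t [[t0 nC]|->]; first exact: capped_exit_le_out.
by apply: le_trans (capped_exit_le _ _ k0) _; rewrite ler_nat ltnS.
Qed.

Let tau_lim w : limn (fun k : nat => (rho k.+1%:R w)%:E) = tau w.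
Proof.
apply/cvg_lim => //.
rewrite [X in _ --> X](_ : _ = ereal_sup (range (fun k : nat => (rho k.+1%:R w)%:E))).
  exact: ereal_nondecreasing_cvgn.
apply/eqP; rewrite eq_le; apply/andP; split; last first.
  by apply: ge_ereal_sup => _ [k _ <-]; exact: rho_le_tau.
set s := ereal_sup _.
have rs k : ((rho k.+1%:R w)%:E <= s)%E by apply: ereal_sup_ubound; exists k.
case E : s => [a| |]; first by apply: tau_le_of => k; rewrite -lee_fin -E.
- exact: leey.
- by have := rs 0%N; rewrite E.
Qed.

Lemma expected_exit_timeE : expected_exit_time P X Omega = (h (x 0 N))%:E.
Proof.
rewrite /expected_exit_time -/tau.
have k0 (k : nat) : 0 < k.+1%:R :> R by rewrite ltr0n.
have rm (k : nat) : measurable_fun setT (fun w => (rho k.+1%:R w)%:E).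
  by apply/measurable_EFinP; exact: rho_measurable.
have r0 (k : nat) w : setT w -> (0 <= (rho k.+1%:R w)%:E)%E.
  by move=> _; rewrite lee_fin; have /andP[] := rho_itv w (k0 k).
have mono := @cvg_monotone_convergence _ _ _ P setT measurableT
  (fun k w => (rho k.+1%:R w)%:E) rm r0 (fun w _ => rho_nd w).
rewrite (_ : (fun w => limn _) = tau) in mono; last exact/funext.
have Ile : (\int[P]_w tau w <= (h (x 0 N))%:E)%E.
  rewrite -(cvg_lim _ mono)//; apply: lime_le; first by apply/cvg_ex; eexists; exact: mono.
  by apply: nearW => k; have [] := integral_rho (k0 k).
have I0 : (0 <= \int[P]_w tau w)%E by exact: integral_ge0.
(* Once finite, the mean makes the correction [B / T] times it as small as desired. *)
have If : (\int[P]_w tau w)%E \is a fin_num.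
  by rewrite ge0_fin_numE//; apply: le_lt_trans Ile _; exact: ltry.
apply/eqP; rewrite eq_le Ile/= -(fineK If) lee_fin.
rewrite -(fineK If) lee_fin in I0.
set i := fine _ in I0 *.
have [B B0 hB] := bound.
apply/ler_addgt0Pr => e e0.
pose k := Num.truncn (B * i / e).
have Bie0 : 0 <= B * i / e by apply: divr_ge0; [apply: mulr_ge0 => //|]; exact: ltW.
have ke : B * i / e < k.+1%:R by have /andP[] := truncn_itv Bie0.
apply: (@le_trans _ _ ((1 + B / k.+1%:R) * i)).
  rewrite -lee_fin; have [_ /(_ B hB)] := integral_rho (k0 k).
  move/le_trans; apply; rewrite EFinM /i (fineK If) lee_wpmul2l//.
    by rewrite lee_fin addr_ge0// divr_ge0// ltW.
  by apply: ge0_le_integral_nonmeasurable => w; [exact: r0|exact: rho_le_tau].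
rewrite mulrDl mul1r lerD2l mulrAC ler_pdivrMr// -ler_pdivrMl// mulrC.
exact: ltW.
Qed.

End ExitTime.

End BrownianExit.

(** * Mean exit times of tubes and caps *)

Section RadialSolutions.
Context {R : realType} {n : nat}.
Local Notation N := (@ord_max n).
Implicit Types (x y : 'rV[R]_n.+1) (D Gamma : set 'rV[R]_n.+1).

Lemma near_eq_derive2 (p q : R -> R) (a : R) : (\forall t \near a, p t = q t) ->
  derive1n 2 p a = derive1n 2 q a.
Proof.
move=> pq; rewrite /derive1n/= !derive1E; apply: near_eq_derive.
have := near_join pq; apply: filterS => t pqt; rewrite !derive1E.
exact: near_eq_derive.
Qed.

Lemma continuous_dotr : continuous (fun x => dotr x x).
Proof.
rewrite (_ : (fun x => dotr x x) = \sum_i (fun x : 'rV[R]_n.+1 => x 0 i * x 0 i)); last first.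
  by apply/funext => x; rewrite dotrE fct_sumE.
move=> x; apply: differentiable_continuous; apply: differentiable_sum => i.
by apply: differentiableM; exact: differentiable_coord.
Qed.

Lemma compact_sphere_height (C : set R) : closed C ->
  compact [set x : 'rV[R]_n.+1 | sphere x /\ C (x 0 N)].
Proof.
move=> Cc.
have := @rV_compact R n.+1 (fun=> [set` `[-1, 1]]) (fun=> @segment_compact R (-1) 1).
move=> /subclosed_compact; apply.
- apply: closedI.
    apply: (@closed_comp _ _ (fun x : 'rV[R]_n.+1 => dotr x x) [set 1]).
      by move=> x _; exact: continuous_dotr.
    exact: closed_eq.
  apply: (@closed_comp _ _ (fun x : 'rV[R]_n.+1 => x 0 N) C) => // x _.
  exact: coord_continuous.
- by move=> x [sx _] i; rewrite /= in_itv/= sphere_coord_itv.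
Qed.

Lemma poisson_solution_height D Gamma (u : 'rV[R]_n.+1 -> R) h h1 h2 :
  C2_on setT h h1 h2 -> D `<=` sphere ->
  (forall x, D x -> \forall y \near x, sphere y -> D y) ->
  (forall x, (D `|` Gamma) x -> u x = h (x 0 N)) ->
  (forall x, D x -> height_laplacian n h1 h2 (x 0 N) = -1) ->
  (forall x, Gamma x -> h (x 0 N) = 0) ->
  poisson_solution D Gamma u.
Proof.
move=> hC2 Ds Do uh hL h0; split.
(* The values of [u] are known only on [D] and [Gamma]; the points of the sphere in this
   neighbourhood all lie in [D]. *)
- move=> x Dx; exists (interior [set y | sphere y -> D y]), (height_fun h).
  split; [exact: open_interior|exact: Do|exact: C2_height_fun hC2|].
  by move=> y /interior_subset Dy sy; apply: uh; left; exact: Dy.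
- apply: (@subspace_eq_continuous _ _ _ (height_fun h)).
    by move=> x; rewrite inE => /uh.
  apply: continuous_subspaceT => x; apply: continuous_height_fun.
  have [dh _ _] := hC2 (x 0 N) Logic.I.
  by apply: differentiable_continuous; apply/derivable1_diffP; exact: ex_derive.
- move=> x Dx; exists (-1); last by rewrite addNr.
  have sx := Ds _ Dx.
  move=> E tE; rewrite -(hL x Dx) -(laplacian_height_fun hC2 sx tE).
  apply: eq_bigr => i _; apply: near_eq_derive2.
  have [ee xe] := frame_row_dot i tE sx.
  have := @continuous_geodesic _ _ x (row i E) 0; rewrite /continuous_at geodesic0 => gc0.
  have gcD : \forall t \near (0 : R), sphere (geodesic x (row i E) t) ->
      D (geodesic x (row i E) t) by exact: (gc0 _ (Do x Dx)).
  apply: filterS gcD => t Dt /=; apply: uh; left; apply: Dt.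
  exact: sphere_geodesic.
- by move=> x Gx; rewrite uh ?h0//; right.
Qed.

Lemma is_the_poisson_solution_height D Gamma (u : 'rV[R]_n.+1 -> R) h h1 h2 :
  C2_on setT h h1 h2 -> D `<=` sphere -> compact (D `|` Gamma) ->
  (forall x, D x -> \forall y \near x, sphere y -> D y) ->
  (forall x, (D `|` Gamma) x -> u x = h (x 0 N)) ->
  (forall x, D x -> height_laplacian n h1 h2 (x 0 N) = -1) ->
  (forall x, Gamma x -> h (x 0 N) = 0) ->
  is_the_poisson_solution D Gamma u.
Proof.
move=> hC2 Ds DGc Do uh hL h0.
have us : poisson_solution D Gamma u by exact: poisson_solution_height hC2 _ _ _ _ _.
split=> // g gs x DGx; apply/eqP; rewrite eq_le.
by rewrite (poisson_le Ds Do DGc us gs)// (poisson_le Ds Do DGc gs us).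
Qed.

Lemma near_sphere_height (V : set R) x : open V -> V (x 0 N) ->
  \forall y \near x, sphere y -> sphere y /\ V (y 0 N).
Proof.
move=> oV Vx.
have nV : \forall y \near (x : 'rV[R]_n.+1), V ((y : 'rV[R]_n.+1) 0 N).
  exact: (@coord_continuous R 1 n.+1 0 N x _ (open_nbhs_nbhs (conj oV Vx))).
by apply: filterS nV => y Vy sy.
Qed.

End RadialSolutions.

Section TubeExit.
Context {R : realType} {n : nat}.
Implicit Types delta : R.
Local Notation N := (@ord_max n).

Lemma sin_itv01 delta : 0 < delta < pi / 2 -> 0 < sin delta < 1.
Proof.
move=> /andP[d0 dp]; apply/andP; split; first by apply: sin_gt0_pi; lra.
by rewrite -sin_pihalf ltr_sin ?in_itv/=; lra.
Qed.

Lemma closed_norm_le (s : R) : closed [set z : R | `|z| <= s].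
Proof.
apply: (@closed_comp _ _ (fun z : R => `|z|) [set z | z <= s]); last exact: closed_le.
by move=> z _; exact: norm_continuous.
Qed.

Lemma closure_norm_gt (s z : R) : closure (~` [set z : R | `|z| <= s]) z -> s <= `|z|.
Proof.
move=> cz; rewrite leNgt; apply/negP => zs.
have oU : open [set z : R | `|z| < s].
  apply: (@open_comp _ _ (fun z : R => `|z|) [set z | z < s]); last exact: open_lt.
  by move=> y _; exact: norm_continuous.
have [y [/= ys ys']] := cz _ (open_nbhs_nbhs (conj oU (zs : [set z : R | `|z| < s] z))).
by apply: ys; exact: ltW.
Qed.

Lemma mean_exit_time_tube delta (d : measure_display)
    (W : 'rV[R]_n.+1 -> measurableType d)
    (P : forall x, probability (W x) R) (X : forall x, R -> W x -> 'rV[R]_n.+1) :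
  (0 < n)%N -> 0 < delta < pi / 2 ->
  (forall x, sphere x -> brownian_motion (P x) x (X x)) ->
  exists h h1 h2 : R -> R,
  [/\ C2_on setT h h1 h2,
      forall z, `|z| <= sin delta -> height_laplacian n h1 h2 z = -1,
      (forall z, h `|z| = h z) /\ h (sin delta) = 0,
      forall r, 0 <= r <= delta -> tube_bound delta n r <= h (sin r) &
      forall x, tube delta x -> mean_exit_time P X (tube delta) x = (h (x 0 N))%:E].
Proof.
move=> n0 d01 XB; have /andP[delta_gt0 delta_lt] := d01.
have sd01 := sin_itv01 d01.
have [h [h1 [h2 [hC2 hL [heven h10] hd]]]] := tube_profile n sd01.
have habs z : h `|z| = h z by have [_|_] := ger0P z => //; exact: heven.
have hbd r : 0 <= r <= delta -> tube_bound delta n r <= h (sin r).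
  have := @tube_profile_ge R delta n.-1 h h1 h2 d01 hC2; rewrite prednK//.
  by move=> /(_ hL h10 hd r).
exists h, h1, h2; split => // x; rewrite tubeE// => -[sx xs].
rewrite /mean_exit_time.
have EE := @expected_exit_timeE R n d (W x) (P x) x (X x) (XB x sx) [set z | `|z| <= sin delta] h h1 h2.
apply: EE => //.
- exact: closed_norm_le.
- by move=> z zs _; exact: hL.
(* Nonnegativity of [h] on the tube is read off from the lower bound, itself nonnegative. *)
- move=> z /= zs _; rewrite -habs.
  have z01 : 0 <= `|z| <= 1 by have := normr_ge0 z; lra.
  have [/andP[a0 a2] sz] := asin_itv z01.
  have dI : asin `|z| <= delta.
    by rewrite leNgt -ltr_sin ?in_itv/= ?sz -?leNgt//; lra.
  rewrite -sz; apply: le_trans (hbd _ _); last by rewrite a0.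
  by apply: tube_bound_ge0 => //; rewrite a0.
- move=> z zs /closure_norm_gt zs' _; rewrite -habs.
  by rewrite (_ : `|z| = sin delta)//; apply/eqP; rewrite eq_le zs' andbT.
- by move=> y sy; split => [[]|ys] //.
Qed.

End TubeExit.

Section CapExit.
Context {R : realType} {n : nat}.
Local Notation N := (@ord_max n).
Implicit Types s : R.

Lemma exit_time_le (d : measure_display) (W : measurableType d)
    (X : R -> W -> 'rV[R]_n.+1) (Om1 Om2 : set 'rV[R]_n.+1) w :
  Om1 `<=` Om2 -> (exit_time X Om1 w <= exit_time X Om2 w)%E.
Proof.
move=> O12; apply: le_ereal_inf => _ [t [t0 nO] <-]; exists t => //; split=> //.
by move=> /O12.
Qed.

Lemma exit_time_ge0 (d : measure_display) (W : measurableType d)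
    (X : R -> W -> 'rV[R]_n.+1) (Om : set 'rV[R]_n.+1) w : (0 <= exit_time X Om w)%E.
Proof. by apply: le_ereal_inf_tmp => _ [t [t0 _] <-]; rewrite lee_fin ltW. Qed.

Lemma expected_exit_time_le (d : measure_display) (W : measurableType d)
    (P : probability W R) (X : R -> W -> 'rV[R]_n.+1) (Om1 Om2 : set 'rV[R]_n.+1) :
  Om1 `<=` Om2 -> (expected_exit_time P X Om1 <= expected_exit_time P X Om2)%E.
Proof.
move=> O12; apply: ge0_le_integral_nonmeasurable => w; first exact: exit_time_ge0.
exact: exit_time_le.
Qed.

Lemma cap_profile_ndecr h h1 h2 s : C2_on setT h h1 h2 ->
  (forall z, s <= z <= 1 -> 0 <= h1 z) ->
  forall a b, s <= a -> a <= b -> b <= 1 -> h a <= h b.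
Proof.
move=> hC2 h1ge0 a b sa ab b1.
have dh (z : R) : is_derive z 1 h (h1 z) by have [] := hC2 z Logic.I.
have [] := @MVT_segment _ h h1 a b ab (fun z _ => dh z).
  by apply: derivable_within_continuous => z _; have dz := dh z; exact: ex_derive.
move=> c; rewrite in_itv/= => /andP[ac cb] E.
rewrite -subr_ge0 E mulr_ge0 ?subr_ge0// h1ge0//.
by rewrite (le_trans sa ac) (le_trans cb b1).
Qed.

(** The equation involves only derivatives of [h], so [h - h a] solves it too and vanishes at [a]:
    one profile serves all closed caps inside the cap of height [s]. *)
Lemma closed_cap_exit_time s h h1 h2 (d : measure_display) (W : measurableType d)
    (P : probability W R) x (X : R -> W -> 'rV[R]_n.+1) a :
  C2_on setT h h1 h2 ->
  (forall z, s <= z <= 1 -> height_laplacian n h1 h2 z = -1) ->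
  (forall z, s <= z <= 1 -> 0 <= h1 z) ->
  brownian_motion P x X -> s <= a -> a <= x 0 N ->
  expected_exit_time P X [set y | sphere y /\ a <= y 0 N] = (h (x 0 N) - h a)%:E.
Proof.
move=> hC2 hL h1ge0 XB sa ax.
have hC2' : C2_on setT (fun z => h z - h a) h1 h2.
  move=> z _; have [d1 d2 c] := hC2 z Logic.I; split=> //.
  by apply: is_derive_eq; rewrite subr0.
apply: (@expected_exit_timeE R n d W P x X XB [set z | a <= z] (fun z => h z - h a) h1 h2) => //.
- by move=> z /= az; rewrite ler_norml => /andP[_ z1]; apply: hL; rewrite (le_trans sa az).
- move=> z /= az; rewrite ler_norml => /andP[_ z1]; rewrite subr_ge0.
  exact: (cap_profile_ndecr hC2 h1ge0).
- move=> z /= az cz _; apply/eqP; rewrite subr_eq0; apply/eqP; congr h.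
  apply/eqP; rewrite eq_le az andbT leNgt; apply/negP => za.
  have [y [/= ya ay]] := cz _ (open_nbhs_nbhs (conj (@open_gt R a) (za : [set y | a < y] z))).
  by apply: ya; exact: ltW.
- by move=> y sy; split => [[]|].
Qed.

(** Exit times grow with the set: the closed cap at [s] gives the upper bound, closed caps at [a]
    slightly above [s] the lower one, with error [h a - h s]. For a starting point at height [s]
    nonnegativity suffices below. *)
Lemma open_cap_exit_time s h h1 h2 (d : measure_display) (W : measurableType d)
    (P : probability W R) x (X : R -> W -> 'rV[R]_n.+1) :
  C2_on setT h h1 h2 ->
  (forall z, s <= z <= 1 -> height_laplacian n h1 h2 z = -1) ->
  (forall z, s <= z <= 1 -> 0 <= h1 z) ->
  brownian_motion P x X -> s <= x 0 N ->
  expected_exit_time P X [set y | sphere y /\ s < y 0 N] = (h (x 0 N) - h s)%:E.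
Proof.
move=> hC2 hL h1ge0 XB sx.
set I := expected_exit_time _ _ _.
have Ile : (I <= (h (x 0 N) - h s)%:E)%E.
  rewrite -(closed_cap_exit_time hC2 hL h1ge0 XB (lexx s) sx).
  by apply: expected_exit_time_le => y [sy /ltW].
apply/eqP; rewrite eq_le Ile/=.
have /predU1P[<-|{}sx] : (s == x 0 N) || (s < x 0 N) by rewrite -le_eqVlt.
  by rewrite subrr; apply: integral_ge0 => w _; exact: exit_time_ge0.
have hc : {for s, continuous h}.
  have [dh _ _] := hC2 s Logic.I.
  by apply: differentiable_continuous; apply/derivable1_diffP; exact: ex_derive.
apply/lee_addgt0Pr => e e0.
have /cvgrPdist_lt/(_ e e0)/nbhs_ballP[eta /= eta0 etaP] := hc.
pose a := s + Num.min (eta / 2) (x 0 N - s).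
have sa : s < a by rewrite ltrDl lt_min subr_gt0 sx andbT divr_gt0.
have ax : a <= x 0 N by rewrite /a -lerBrDl ge_min lexx orbT.
have aeta : a - s <= eta / 2 by rewrite /a addrAC subrr add0r ge_min lexx.
have hsa : `|h s - h a| < e.
  by apply: etaP; rewrite /ball/= distrC ger0_norm ?subr_ge0 ?ltW//; lra.
apply: (@le_trans _ _ ((h (x 0 N) - h a)%:E + e%:E)%E).
  by rewrite -EFinD lee_fin; move: hsa; rewrite ltr_norml => /andP[]; lra.
rewrite leeD2r//.
rewrite -(closed_cap_exit_time hC2 hL h1ge0 XB (ltW sa) ax).
apply: expected_exit_time_le => y [sy ay]; split=> //.
exact: lt_le_trans ay.
Qed.

End CapExit.

(** * Limits of the two bounds as the dimension grows *)

Section Limits.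
Context {R : realType}.

(** Bernoulli's inequality to second order: the quadratic term is what outgrows the factor n in the
    denominator of [tube_bound]. *)
Lemma expr1D_ge (b : R) m : 0 <= b ->
  1 + m%:R * b + m%:R * (m%:R - 1) / 2 * b ^+ 2 <= (1 + b) ^+ m.
Proof.
move=> b0; elim: m => [|m IHm]; first by rewrite expr0 !mul0r !addr0.
have b1 : 0 <= 1 + b by lra.
rewrite [(1 + b) ^+ _]exprSr; apply: (le_trans _ (ler_wpM2r b1 IHm)).
rewrite -subr_ge0 -natr1 (_ : _ - _ = m%:R * (m%:R - 1) / 2 * b ^+ 3); last by field.
case: m {IHm} => [|m]; first by rewrite !mul0r.
by rewrite mulr_ge0 ?exprn_ge0// divr_ge0// mulr_ge0// -natr1 addrK.
Qed.

Lemma cvg_tube_bound (delta r : R) : 0 < delta < pi / 2 -> 0 < r < delta ->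
  (fun n => tube_bound delta n r) @ \oo --> +oo.
Proof.
move=> /andP[d0 dp] /andP[r0 rd].
have sd : 0 < sin delta by apply: sin_gt0_pi; lra.
have sr : 0 < sin r by apply: sin_gt0_pi; lra.
have c0 : 0 < cos r by apply: cos_gt0_pihalf; lra.
have c1 : cos r < 1.
  by rewrite -cos0 ltr_cos// in_itv/=; have := pi_gt0 R; lra.
pose b := (cos r)^-1 - 1.
have b0 : 0 < b by rewrite subr_gt0 invf_gt1.
pose K := (delta - r) / sin delta * ((1 - cos r) * (b ^+ 2 / 2)).
have K0 : 0 < K.
  apply: mulr_gt0; first by rewrite divr_gt0// subr_gt0.
  by rewrite mulr_gt0 ?subr_gt0// divr_gt0// exprn_gt0.
(* With m + 1 as dimension, (m + 1)(m - 2) <= m (m - 1); dividing the quadratic term by m + 1 thus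
   leaves m - 2, which is the dimension minus 3. *)
have lower m : (2 < m)%N -> K * (m%:R - 3) <= tube_bound delta m r.
  case: m => // m m2; rewrite /tube_bound/= /K -[leLHS]mulrA.
  apply: ler_wpM2l; first by rewrite divr_ge0 ?subr_ge0 ?ltW.
  rewrite -[leLHS]mulrA; apply: ler_pM.
  - by rewrite subr_ge0 ltW.
  - apply: mulr_ge0; first by rewrite divr_ge0// sqr_ge0.
    by rewrite subr_ge0 (ler_nat _ 3).
  - rewrite lerD2l lerN2 exprS; apply: ler_piMr; first exact: ltW.
    by apply: exprn_ile1; exact: ltW.
  have m0 : 0 < m.+1%:R :> R by rewrite ltr0n.
  rewrite invfM -ler_pdivrMl ?invr_gt0// invrK.
  apply: le_trans (_ : (1 + b) ^+ m <= _); last by rewrite /b addrC subrK exprVn.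
  apply: (le_trans _ (expr1D_ge m (ltW b0))).
  have mb : 0 <= m%:R * b by rewrite mulr_ge0// ltW.
  have bb := sqr_ge0 b.
  by rewrite -natr1; nra.
apply/cvgryPge => M.
near=> n.
apply: le_trans (lower n _); last by near: n; exact: nbhs_infty_gt.
rewrite mulrC -ler_pdivrMr// lerBrDr.
by near: n; exact: nbhs_infty_ger.
Unshelve. all: by end_near. Qed.

Lemma cvg_ball_bound (delta : R) : (fun n => ball_bound delta n) @ \oo --> (0 : R).
Proof.
set c := (1 - cos (pi / 2 - delta)) / cos (pi / 2 - delta).
rewrite (_ : (fun n => _) = (fun n => c * n%:R^-1)); last first.
  by apply/funext => n; rewrite /ball_bound /c invfM mulrAC mulrA.
rewrite -(mulr0 c); apply: cvgMr; rewrite -(cvg_shiftS (fun n : nat => n%:R^-1 : R)).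
exact: cvg_harmonic.
Qed.

End Limits.

(** * From heights back to distances, tubes and balls *)

Theorem theorem1p1 (R : realType) (delta : R)
    (delta_gt0 : 0 < delta) (delta_lt : delta < pi / 2) :
  ((forall (n : nat) (d : measure_display)
      (W : 'rV[R]_n.+1 -> measurableType d)
      (P : forall x, probability (W x) R)
      (X : forall x, R -> W x -> 'rV[R]_n.+1),
      (1 <= n)%N ->
      (forall x, sphere x -> brownian_motion (P x) x (X x)) ->
      let E := mean_exit_time P X (tube delta) in
      let u := fun x => fine (E x) in
      [/\ forall x, tube delta x -> E x \is a fin_num,
          is_the_poisson_solution
            (tube delta `\` tube_boundary delta) (tube_boundary delta) u,
          exists phi : R -> R,
            forall x, tube delta x -> u x = phi (dist_equator x) &
          forall x, tube delta x ->
            tube_bound delta n (dist_equator x) <= u x])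
   /\ (forall r : R, 0 < r < delta ->
         (fun n => tube_bound delta n r) @ \oo --> +oo))
  /\
  ((forall (n : nat) (d : measure_display)
      (W : 'rV[R]_n.+1 -> measurableType d)
      (P : forall x, probability (W x) R)
      (X : forall x, R -> W x -> 'rV[R]_n.+1),
      (1 <= n)%N ->
      (forall x, sphere x -> brownian_motion (P x) x (X x)) ->
      let B := geodesic_ball north_pole (pi / 2 - delta) in
      let bB := geodesic_sphere north_pole (pi / 2 - delta) in
      let E := mean_exit_time P X B in
      let v := fun y => fine (E y) in
      [/\ forall y, (B `|` bB) y -> E y \is a fin_num,
          is_the_poisson_solution B bB v,
          exists phi : R -> R,
            forall y, (B `|` bB) y -> v y = phi (sdist y north_pole) &
          forall y, B y -> v y <= ball_bound delta n])
   /\ (fun n => ball_bound delta n) @ \oo --> (0 : R)).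
Proof.
have d01 : 0 < delta < pi / 2 by rewrite delta_gt0.
have sd01 := sin_itv01 d01.
split; split.
- move=> n d W P X n0 XB E u.
  have [h [h1 [h2 [hC2 hL [habs hd] hbd EE]]]] := mean_exit_time_tube n0 d01 XB.
  have uE x : tube delta x -> u x = h (x 0 ord_max) by move=> tx; rewrite /u /E EE.
  have tubeS : (tube delta `\` tube_boundary delta) `|` tube_boundary delta
      = tube delta :> set 'rV[R]_n.+1.
    by rewrite setUC setDUK// => x [sx xd]; split=> //; rewrite xd.
  have DE : tube delta `\` tube_boundary delta =
      [set x : 'rV[R]_n.+1 | sphere x /\ [set z : R | `|z| < sin delta] (x 0 ord_max)].
    rewrite tubeE// tube_boundaryE//; apply/seteqP; split => x.
      move=> [[sx xs] nx]; split=> //=; rewrite lt_neqAle xs andbT.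
      by apply/eqP => xE; apply: nx.
    by move=> [sx /= xs]; split; [split=> //; exact: ltW|move=> [_ xE]; rewrite xE ltxx in xs].
  split.
  + by move=> x tx; rewrite /E EE.
  + apply: (is_the_poisson_solution_height hC2).
    * by move=> x [[]].
    * rewrite tubeS tubeE//; apply: (@compact_sphere_height R n [set z : R | `|z| <= sin delta]).
      exact: closed_norm_le.
    * rewrite DE => x [sx xs]; apply: near_sphere_height => //.
      apply: (@open_comp _ _ (fun z : R => `|z|) [set z | z < sin delta]); last exact: open_lt.
      by move=> y _; exact: norm_continuous.
    * by rewrite tubeS.
    * by rewrite DE => x [_ /= xs]; apply: hL; exact: ltW.
    * by rewrite tube_boundaryE// => x [_ xs]; rewrite -habs xs.
  (* The sine of the distance to the equator is the absolute height, and [h] is even. *)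
  + exists (fun r => h (sin r)) => x tx; rewrite uE//.
    by have [_ ->] := sin_dist_equator n0 tx.1; rewrite habs.
  + move=> x tx; rewrite uE//; have [sx xd] := tx.
    have [/andP[x0 _] sE] := sin_dist_equator n0 sx.
    by rewrite -habs -sE; apply: hbd; rewrite x0.
- by move=> r r0d; exact: cvg_tube_bound.
- move=> n d W P X n0 XB B bB E v.
  set s := cos (pi / 2 - delta).
  have s01 : 0 < s < 1.
    by rewrite /s cosB cos_pihalf sin_pihalf mul0r add0r mul1r.
  have [s0 s1] := andP s01.
  have [h [h1 [h2 [hC2 hL hs hb]]]] := cap_profile n0 s01.
  have h1ge0 z : s <= z <= 1 -> 0 <= h1 z by move=> /hb/andP[].
  have rI : 0 <= pi / 2 - delta <= pi by lra.
  have BE : B = [set y | sphere y /\ s < y 0 ord_max] by exact: geodesic_ballE.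
  have bBE : bB = [set y | sphere y /\ y 0 ord_max = s] by exact: geodesic_sphereE.
  have BbB : B `|` bB = [set y | sphere y /\ [set z : R | s <= z] (y 0 ord_max)].
    rewrite BE bBE; apply/seteqP; split => y /=.
      by move=> [[sy /ltW]|[sy ->]].
    move=> [sy]; rewrite le_eqVlt => /predU1P[ys|ys]; [right|left] => //.
  have EE y : (B `|` bB) y -> E y = (h (y 0 ord_max))%:E.
    rewrite BbB => -[sy ys]; rewrite /E /mean_exit_time BE.
    by rewrite (open_cap_exit_time hC2 hL h1ge0 (XB y sy) ys) hs subr0.
  have vE y : (B `|` bB) y -> v y = h (y 0 ord_max) by move=> /EE; rewrite /v => ->.
  split.
  + by move=> y /EE ->.
  + apply: (is_the_poisson_solution_height hC2) => //.
    * by move=> x [].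
    * rewrite BbB; apply: (@compact_sphere_height R n [set z : R | s <= z]).
      exact: closed_ge.
    * rewrite BE => x [sx xs]; apply: (@near_sphere_height R n [set z : R | s < z]) => //.
    * rewrite BE => x [sx xs]; apply: hL; rewrite ltW//=.
      by have /andP[] := sphere_coord_itv ord_max sx.
    * by rewrite bBE => x [_ ->].
  + exists (fun t => h (cos t)) => y yB; rewrite vE// sdist_north_pole acosK// in_itv/=.
    by move: yB; rewrite BbB => -[sy _]; exact: sphere_coord_itv.
  + move=> y yB; rewrite vE; last by left.
    move: yB; rewrite BE => -[sy ys].
    have /andP[_ y1] := sphere_coord_itv ord_max sy.
    have dh (z : R) : is_derive z 1 h (h1 z) by have [] := hC2 z Logic.I.
    have hc : {within `[s, y 0 ord_max], continuous h}.
      by apply: derivable_within_continuous => z _; have dz := dh z; exact: ex_derive.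
    (* With [s < c], the derivative at [c] is at most 1 / (n c) <= 1 / (n s), and the height gained
       is at most 1 - s; the product is [ball_bound]. *)
    have [c] := MVT ys (fun z _ => dh z) hc.
    rewrite in_itv/= hs subr0 => /andP[sc cy] ->.
    have c0 : 0 < c := lt_trans s0 sc.
    have nR : 0 < n%:R :> R by rewrite ltr0n.
    have hc1 : h1 c <= (n%:R * s)^-1.
      have /andP[_ hcle] : 0 <= h1 c <= (n%:R * c)^-1 by apply: hb; lra.
      by apply: le_trans hcle _; rewrite lef_pV2 ?posrE ?mulr_gt0// ler_pM2l// ltW.
    rewrite /ball_bound -/s [leRHS]mulrC.
    apply: ler_pM => //; [by apply: h1ge0; lra|by rewrite subr_ge0 ltW|by rewrite lerD2r].
- exact: cvg_ball_bound.
Qed.
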